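(* Let $\alpha>-1$ and let $\{a_k\}_{k=0}^\infty$ be a sequence of real numbers. Let $p(y)=\sum_{k=0}^{\infty}\binom{k+\alpha}{k}a_k y^k$ be the associated formal power series, and define $\lambda_n:=\sum_{k=0}^{n}a_k\binom{n}{k}$ for $n\in\mathbb{N}$. Suppose the sequence $\{\lambda_n\}_{n=0}^\infty$ is non-trivial. Then $\{\lambda_n\}_{n=0}^\infty$ is an $\mathscr{L}_\alpha$-multiplier sequence if and only if $p(y)$ is a real-rooted polynomial all of whose zeros lie in the interval $[-1,0]$.
   Context: For $\alpha>-1$, the generalized Laguerre polynomials are $L_n^{(\alpha)}(x)=\sum_{k=0}^{n}\binom{n+\alpha}{n-k}\frac{(-x)^k}{k!}$, $n\in\mathbb{N}=\{0,1,2,\dots\}$, and $\mathscr{L}_\alpha=\{L_n^{(\alpha)}\}_{n=0}^\infty$ (a basis of $\mathbb{R}[x]$). Here $\binom{m+\alpha}{j}=\frac{(m+\alpha)(m+\alpha-1)\cdots(m+\alpha-j+1)}{j!}$. A real sequence $\{\lambda_n\}$ is an $\mathscr{L}_\alpha$-multiplier sequence if the linear operator $T:\mathbb{R}[x]\to\mathbb{R}[x]$ defined by $T(L_n^{(\alpha)})=\lambda_nL_n^{(\alpha)}$ for all $n$ maps real-rooted polynomials to real-rooted polynomials (constant polynomials, including $0$, count as real-rooted). A sequence $\{\lambda_n\}$ is trivial if there is $k\in\mathbb{N}$ such that $\lambda_n=0$ for all $n\notin\{k,k+1\}$; otherwise it is non-trivial. *)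

(* Defs.v *)
From Stdlib Require Import Reals List Arith.
Open Scope R_scope.

Definition prodl (l : list R) : R := fold_right Rmult 1 l.

(* A real polynomial function f is real-rooted iff it factors over R as
   c * prod (x - r_i); constants (incl. 0) are real-rooted (empty root list). *)
Definition real_rooted (f : R -> R) : Prop :=
  exists (c : R) (rs : list R),
    forall x, f x = c * prodl (map (fun r => x - r) rs).

Fixpoint gbinom (t : R) (j : nat) : R :=
  match j with
  | O => 1
  | S j' => gbinom t j' * (t - INR j') / INR (S j')
  end.

Definition Laguerre (alpha : R) (n : nat) (x : R) : R :=
  sum_f_R0 (fun k => gbinom (INR n + alpha) (n - k) * (- x) ^ k / INR (Factorial.fact k)) n.

(* {lam_n} is an L_alpha-multiplier sequence: the linear operator T with
   T(L_n) = lam_n L_n preserves real-rootedness.  Every polynomial is uniquely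
   sum_{n<=N} c_n L_n, and T maps it to sum_{n<=N} lam_n c_n L_n. *)
Definition Lag_multiplier_seq (alpha : R) (lam : nat -> R) : Prop :=
  forall (N : nat) (c : nat -> R),
    real_rooted (fun x => sum_f_R0 (fun n => c n * Laguerre alpha n x) N) ->
    real_rooted (fun x => sum_f_R0 (fun n => lam n * c n * Laguerre alpha n x) N).

Definition trivial_seq (lam : nat -> R) : Prop :=
  exists k : nat, forall n : nat, n <> k -> n <> S k -> lam n = 0.

Definition poly_rr_in_m10 (b : nat -> R) : Prop :=
  exists N : nat, (forall k, (N < k)%nat -> b k = 0) /\
    exists (c : R) (rs : list R),
      (forall r, In r rs -> -1 <= r <= 0) /\
      forall y, sum_f_R0 (fun k => b k * y ^ k) N = c * prodl (map (fun r => y - r) rs).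

(* Main.v *)
(** Put [b k = binom (k + alpha) k * a k], so that [p y = sum_k b k * y ^ k], and [s = alpha + 1].
    With [D = d/dx], the operator [T] sending [L_n] to [lam n * L_n] is
      [T = sum_k (-1)^k b_k sum_{j <= k} binom(k,j) / (s)_j (-x)^j (1 - D)^j D^k],
    because [D L_n^(be) = - L_(n-1)^(be+1)] and [(1 - D) L_n^(be) = L_n^(be+1)].

    Sufficiency.  For fixed [x], [T f x = (F_x(D) f) x] for a polynomial [F_x].  If the zeros of [p]
    lie between -1 and 0 and [Im x > 0], then all roots of [F_x] have nonnegative imaginary part, and a
    factor [D - y] with [Im y >= 0] preserves nonvanishing on the upper half plane.

    Necessity.  For large [N] put [E x w = T ((X + w)^N) x].  Since [c (X + w)^N] plus its conjugate is
    real-rooted for [Im w > 0], the moduli of [E x w] and [E x (conj w)] never agree for [x], [w] in the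
    upper half plane, so their difference has a constant sign there.  Letting [x = i e] tend to 0,
    [A w = E 0 w = sum_i N(N-1)..(N-i+1) (-1)^i b_i w^(N-i)] is real-rooted and [Im (V * conj A)] has a
    constant sign, where [V], the [x]-derivative of [s E] at 0, is [(w + N + alpha) A' - N A - w A''].
    The growth of such a quotient [V / A] on the imaginary axis is limited by its two leading
    coefficients, which bounds the number of nonzero roots of [A] independently of [N]; so [p] is a
    polynomial, of degree [M] say.  Rescaling [w] by [N] and letting [N] tend to infinity, the same sign
    condition holds for [B w = sum_k (-1)^k b_k w^(M-k)] in place of [A] and the first-order expression
    [(M + s - M w) B + w (w - 1) B'], compared with [w B].  Near a root of [B] smaller than 1 the pole of
    the logarithmic derivative has the wrong sign, so all roots of [B] are at least 1, and the zeros of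
    [p] are 0 or the numbers [- 1 / r] for these roots [r]. *)
Require Import Defs.
From Stdlib Require Import Reals List.
From HB Require Import structures.
From mathcomp Require Import all_boot all_order all_algebra.
From mathcomp.real_closed Require Import complex polyrcf.
From mathcomp Require Import Rstruct zify ring lra.
Set Implicit Arguments.
Unset Strict Implicit.
Unset Printing Implicit Defensive.
Import Order.TTheory GRing.Theory Num.Theory.
Local Open Scope ring_scope.
Local Open Scope complex_scope.
Local Notation Re := complex.Re.
Local Notation Im := complex.Im.

(** * Real and imaginary parts and the squared modulus *)

Section ComplexNumbers.
Variable R : rcfType.
Implicit Types (z w : R[i]) (x y : R).

Lemma ReM z w : Re (z * w) = Re z * Re w - Im z * Im w.
Proof. by case: z; case: w. Qed.

Lemma ImM z w : Im (z * w) = Re z * Im w + Im z * Re w.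
Proof. by case: z; case: w. Qed.

Lemma ReD z w : Re (z + w) = Re z + Re w.
Proof. by case: z; case: w. Qed.

Lemma ImD z w : Im (z + w) = Im z + Im w.
Proof. by case: z; case: w. Qed.

Lemma ReN z : Re (- z) = - Re z.
Proof. by case: z. Qed.

Lemma ImN z : Im (- z) = - Im z.
Proof. by case: z. Qed.

Lemma ReJ z : Re (conjc z) = Re z.
Proof. by case: z. Qed.

Lemma ImJ z : Im (conjc z) = - Im z.
Proof. by case: z. Qed.

Lemma Re_sum (I : Type) (r : seq I) (P : pred I) (F : I -> R[i]) :
  Re (\sum_(i <- r | P i) F i) = \sum_(i <- r | P i) Re (F i).
Proof. exact: (big_morph _ ReD (erefl _)). Qed.

Lemma Im_sum (I : Type) (r : seq I) (P : pred I) (F : I -> R[i]) :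
  Im (\sum_(i <- r | P i) F i) = \sum_(i <- r | P i) Im (F i).
Proof. exact: (big_morph _ ImD (erefl _)). Qed.

(* The squared modulus, as an element of R: [`|z|] lives in R[i]. *)
Definition nsq z : R := Re z ^+ 2 + Im z ^+ 2.

Lemma nsq_ge0 z : 0 <= nsq z.
Proof. by rewrite addr_ge0 ?sqr_ge0. Qed.

Lemma nsqM z w : nsq (z * w) = nsq z * nsq w.
Proof. by rewrite /nsq ReM ImM; ring. Qed.

Lemma nsqJ z : nsq (conjc z) = nsq z.
Proof. by rewrite /nsq ReJ ImJ sqrrN. Qed.

Lemma nsqN z : nsq (- z) = nsq z.
Proof. by rewrite /nsq ReN ImN !sqrrN. Qed.

Lemma nsqX z n : nsq (z ^+ n) = nsq z ^+ n.
Proof.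
elim: n => [|n IH]; first by rewrite !expr0 /nsq /= expr0n expr1n addr0.
by rewrite !exprS nsqM IH.
Qed.

Lemma nsq_eq0 z : (nsq z == 0) = (z == 0).
Proof. by rewrite /nsq paddr_eq0 ?sqr_ge0 // !sqrf_eq0 eq_complex. Qed.

Lemma nsq_gt0 z : (0 < nsq z) = (z != 0).
Proof. by rewrite lt0r nsq_ge0 andbT nsq_eq0. Qed.

Lemma nsq_real x : nsq x%:C = x ^+ 2.
Proof. by rewrite /nsq /= expr0n addr0. Qed.

Lemma nsq_prod (I : Type) (r : seq I) (F : I -> R[i]) :
  nsq (\prod_(i <- r) F i) = \prod_(i <- r) nsq (F i).
Proof. by apply: (big_morph _ nsqM); rewrite nsq_real expr1n. Qed.

Lemma mulcJ z : z * conjc z = (nsq z)%:C.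
Proof. by case: z => a b; apply/eqP; rewrite eq_complex /nsq /=; apply/andP; split; apply/eqP; ring. Qed.

Lemma Im_inv z : Im z^-1 = - Im z / nsq z.
Proof. by case: z => a b; rewrite mulNr. Qed.

Lemma Re_inv z : Re z^-1 = Re z / nsq z.
Proof. by case: z. Qed.

Lemma Im_div z w : Im (z / w) = Im (z * conjc w) / nsq w.
Proof. by rewrite !ImM ReJ ImJ Im_inv Re_inv; ring. Qed.

Lemma Im_inv_lt0 z : 0 < Im z -> Im z^-1 < 0.
Proof.
move=> hz; rewrite Im_inv mulNr oppr_lt0 divr_gt0 // nsq_gt0.
by apply: contraTneq hz => ->; rewrite ltxx.
Qed.

Lemma Im_neq0 z : Im z != 0 -> z != 0.
Proof. by apply: contraNneq => ->. Qed.

Lemma Im_real x z : Im (x%:C * z) = x * Im z.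
Proof. by rewrite ImM /= mul0r addr0. Qed.

Lemma Re_real x z : Re (x%:C * z) = x * Re z.
Proof. by rewrite ReM /= mul0r subr0. Qed.

End ComplexNumbers.

(** * Polynomials without zeros in the open upper half plane *)

Section Stable.
Variable R : rcfType.
Implicit Types (p q : {poly R[i]}) (z w : R[i]) (rs : seq R[i]).

(** The zero polynomial is not stable, which is why [rr_stable] has a separate case for it. *)
Definition stable p := forall z, 0 < Im z -> p.[z] != 0.

Lemma horner_prod_XsubC (K : comNzRingType) (rs : seq K) (z : K) :
  (\prod_(r <- rs) ('X - r%:P)).[z] = \prod_(r <- rs) (z - r).
Proof. by rewrite horner_prod; apply: eq_bigr => r _; rewrite hornerXsubC. Qed.

Lemma logderiv_prod (K : fieldType) (rs : seq K) (z : K) :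
    z \notin rs ->
  let P := \prod_(r <- rs) ('X - r%:P) in
  P^`().[z] = P.[z] * \sum_(r <- rs) (z - r)^-1.
Proof.
elim: rs => [|r rs IH] /=; first by rewrite !big_nil derivC horner0 mulr0.
rewrite inE negb_or => /andP[zr /IH {}IH]; rewrite !big_cons derivM derivXsubC mul1r.
rewrite hornerD !hornerM hornerXsubC IH mulrDr.
have h : z - r != 0 by rewrite subr_eq0.
by field.
Qed.

Lemma poly_factor p :
  exists rs, p = lead_coef p *: \prod_(r <- rs) ('X - r%:P).
Proof. by have [rs] := closed_field_poly_normal p; exists rs. Qed.

Lemma stable_roots p c rs :
  stable p -> p = c *: \prod_(r <- rs) ('X - r%:P) ->
  {in rs, forall r, Im r <= 0}.
Proof.
move=> sp hp r rrs; rewrite leNgt; apply/negP => /sp.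
by rewrite hp hornerZ horner_prod_XsubC (big_rem r rrs) /= subrr mul0r mulr0 eqxx.
Qed.

Lemma Im_sum_inv_lt0 rs z :
    0 < Im z -> {in rs, forall r, Im r <= 0} ->
  Im (\sum_(r <- rs) (z - r)^-1) <= 0 /\
  (rs != [::] -> Im (\sum_(r <- rs) (z - r)^-1) < 0).
Proof.
move=> z0; elim: rs => [|r rs IH] h; first by rewrite big_nil.
have [IH1 _] : Im (\sum_(r <- rs) (z - r)^-1) <= 0 /\
  (rs != [::] -> Im (\sum_(r <- rs) (z - r)^-1) < 0).
  by apply: IH => s srs; apply: h; rewrite inE srs orbT.
have lt : Im (z - r)^-1 < 0.
  by apply: Im_inv_lt0; rewrite ImD ImN; have := h r (mem_head _ _); lra.
by rewrite big_cons ImD; split; lra.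
Qed.

(** The logarithmic derivative is the sum of [1 / (z - r)] over the roots, and each term has
    negative imaginary part because [Im r <= 0 < Im z]. *)
Lemma stable_logderiv p z :
    stable p -> 0 < Im z ->
  Im (p^`().[z] / p.[z]) <= 0 /\ ((1 < size p)%N -> Im (p^`().[z] / p.[z]) < 0).
Proof.
move=> sp z0; have pz := sp _ z0; have [rs hp] := poly_factor p.
have hrs := stable_roots sp hp.
have zrs : z \notin rs.
  by apply/negP => /hrs; rewrite leNgt z0.
have p0 : lead_coef p != 0.
  by apply: contraNneq pz => h; rewrite hp h scale0r horner0.
have -> : p^`().[z] / p.[z] = \sum_(r <- rs) (z - r)^-1.
  move: pz; rewrite hp derivZ !hornerZ logderiv_prod //= => pz.
  by rewrite mulrA mulrAC divff ?mul1r.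
have [h1 h2] := Im_sum_inv_lt0 z0 hrs; split=> // sz; apply: h2.
by apply: contraTneq sz => rs0; rewrite hp rs0 big_nil alg_polyC size_polyC p0.
Qed.

(** Half-plane case of the Gauss-Lucas theorem: at a zero of the derivative the logarithmic
    derivative would vanish. *)
Lemma stable_deriv p : (1 < size p)%N -> stable p -> stable p^`().
Proof.
move=> sz sp z z0; have [_ /(_ sz)] := stable_logderiv sp z0.
by apply: contraTneq => ->; rewrite mul0r ltxx.
Qed.

(** At a zero the logarithmic derivative would equal [w], whose imaginary part has the wrong sign;
    constant [p] is covered by [w != 0]. *)
Lemma stable_deriv_sub p w :
  w != 0 -> 0 <= Im w -> stable p -> stable (p^`() - w *: p).
Proof.
move=> w0 hw sp z z0; have [h1 h2] := stable_logderiv sp z0; have pz := sp _ z0.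
rewrite hornerD hornerN hornerZ subr_eq0; apply/eqP => e.
move: h1 h2; rewrite e mulfK // => h1; case: ltnP => [_ /(_ isT)|]; first by lra.
move=> /size1_polyC pc _; move: e pz; rewrite pc derivC horner0 hornerC.
by move=> /esym/eqP; rewrite mulf_eq0 (negPf w0) /= => ->.
Qed.

End Stable.

(** * Real-rootedness and its relation to stability *)

Section RealRooted.
Variable R : rcfType.
Implicit Types (p q : {poly R}) (z : R[i]).
Local Notation toC := (map_poly (real_complex R)).

Definition rr p := exists c rs, p = c *: \prod_(r <- rs) ('X - r%:P).

Lemma rr0 : rr 0.
Proof. by exists 0, [::]; rewrite scale0r. Qed.

Lemma horner_toCJ p z : (toC p).[conjc z] = conjc (toC p).[z].
Proof.
have -> : toC p = map_poly conjc (toC p).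
  by apply/polyP => i; rewrite !coef_map /= oppr0.
by rewrite horner_map; congr (conjc _); congr (_.[z]); apply/polyP => i; rewrite !coef_map /= oppr0.
Qed.

Lemma rr_stable p : rr p -> p = 0 \/ stable (toC p).
Proof.
move=> [c [rs ->]]; have [->|c0] := eqVneq c 0; first by left; rewrite scale0r.
right=> z z0; rewrite linearZ /= hornerZ mulf_neq0 //.
  by rewrite fmorph_eq0.
rewrite rmorph_prod horner_prod; rewrite prodf_seq_neq0; apply/allP => r _ /=.
rewrite rmorphB /= map_polyX map_polyC hornerXsubC; apply: Im_neq0.
by rewrite ImD ImN /= subr0 gt_eqF.
Qed.

(** The roots of a real polynomial are symmetric under conjugation, so if they are confined to the
    closed lower half plane they are real. *)
Lemma stable_rr p : stable (toC p) -> rr p.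
Proof.
move=> sp; have [rs hp] := poly_factor (toC p).
have hrs := stable_roots sp hp.
have h r : r \in rs -> (Re r)%:C = r.
  move=> rrs; suff : Im r = 0 by case: (r) => a b /= ->.
  apply/eqP; rewrite eq_le hrs //= leNgt; apply/negP => r0.
  have : 0 < Im (conjc r) by rewrite ImJ oppr_gt0.
  move/sp; rewrite horner_toCJ {1}hp hornerZ horner_prod_XsubC (big_rem r rrs) /=.
  by rewrite subrr mul0r mulr0 conjc0 eqxx.
exists (lead_coef p), (map (@complex.Re R) rs); apply: (map_poly_inj (real_complex R)).
rewrite hp lead_coef_map linearZ /= rmorph_prod /= big_map; congr (_ *: _).
by apply: eq_big_seq => r /h hr; rewrite rmorphB /= map_polyX map_polyC /= hr.
Qed.

Lemma rr_deriv p : rr p -> rr p^`().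
Proof.
move=> hp; have [sp|sp] := leqP (size p) 1.
  by rewrite (size1_polyC sp) derivC; apply: rr0.
apply: stable_rr; rewrite -deriv_map; apply: stable_deriv; first by rewrite size_map_poly.
by have [p0|] := rr_stable hp => //; rewrite p0 size_poly0 in sp.
Qed.

End RealRooted.

(** * Pochhammer symbols and the transform that divides by them *)

Section Pochhammer.
Variable K : fieldType.
Implicit Types (a : K) (Q : {poly K}).

Definition poch a j := \prod_(i < j) (a + i%:R).

Lemma poch0 a : poch a 0 = 1.
Proof. by rewrite /poch big_ord0. Qed.

Lemma pochS a j : poch a j.+1 = poch a j * (a + j%:R).
Proof. by rewrite /poch big_ord_recr. Qed.

Lemma pochSl a j : poch a j.+1 = a * poch (a + 1) j.
Proof.
rewrite /poch big_ord_recl addr0; congr (_ * _); apply: eq_bigr => i _.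
by rewrite lift0 -addrA nat1r.
Qed.

(* The transform sum_j Q_j w^j -> sum_j Q_j (-x)^j / (a)_j. *)
Definition pochtr a Q := \poly_(j < size Q) ((-1) ^+ j * Q`_j / poch a j).

Lemma coef_pochtr a Q j : (pochtr a Q)`_j = (-1) ^+ j * Q`_j / poch a j.
Proof. by rewrite coef_poly; case: ltnP => // /(nth_default 0) ->; rewrite mulr0 mul0r. Qed.

(** Absorbing a linear factor raises the parameter to [a + 1] and costs a first-order differential
    expression; this drives the induction in [pochtr_stable]. On coefficients it rests on
    [(a)_(j+1) = a (a+1)_j]. *)
Lemma pochtr_mul a k Q : (forall j, a + j%:R != 0) ->
  a *: pochtr a ((1 + k *: 'X) * Q) =
  a *: pochtr (a + 1) Q + 'X * (pochtr (a + 1) Q)^`() - k *: ('X * pochtr (a + 1) Q).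
Proof.
move=> ha; have pn j : poch a j != 0 by apply/prodf_neq0 => i _.
have pn1 j : poch (a + 1) j != 0.
  by apply/prodf_neq0 => i _; rewrite -addrA nat1r.
have a0 : a != 0 by rewrite -[a]addr0 (ha 0).
apply/polyP => j; rewrite coefZ coef_pochtr mulrDl mul1r -scalerAl.
rewrite !coefD coefN !coefZ !coefXM coef_deriv !coef_pochtr.
case: j => [|j] /=; first by rewrite !poch0 expr0 !divr1 !mulr0 subr0 !addr0.
rewrite pochSl [poch (a + 1) j.+1]pochS.
have -> : a + 1 + j%:R = a + j.+1%:R by rewrite -nat1r addrA.
have hj := ha j.+1; have pj := pn1 j.
rewrite -(mulr_natr (_ / _)) exprS; move: (j.+1%:R : K) hj => J hj.
by field; rewrite pj a0 hj.
Qed.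

End Pochhammer.

(** * Stability of the Pochhammer transform *)

Section PochStable.
Variable R : rcfType.

(** Induction on the factors, with [a] varying. With [P] the transform of the remaining factors at
    parameter [a + 1], a zero [z] would force [k = a / z + P' / P] at [z], whose right-hand side has
    negative imaginary part. *)
Lemma pochtr_stable (ks : seq R[i]) (a : R) : 0 < a -> {in ks, forall k, 0 <= Im k} ->
  stable (pochtr a%:C (\prod_(k <- ks) (1 + k *: 'X))).
Proof.
elim: ks a => [|k ks IH] a a0 h.
  move=> z z0; rewrite big_nil -[pochtr _ _]/(pochtr _ 1).
  have -> : pochtr a%:C 1 = 1.
    apply/polyP => -[|j]; rewrite coef_pochtr !coefC /=; first by rewrite poch0 mul1r divr1.
    by rewrite mulr0 mul0r.
  by rewrite hornerC oner_eq0.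
have {}IH : stable (pochtr (a%:C + 1) (\prod_(k <- ks) (1 + k *: 'X))).
  have -> : a%:C + 1 = (a + 1)%:C by rewrite rmorphD rmorph1.
  by apply: IH => [|l lks]; [lra | apply: h; rewrite inE lks orbT].
have hk : 0 <= Im k by apply: h; rewrite mem_head.
rewrite big_cons; set Q := \prod_(_ <- _) _ in IH *; set P := pochtr _ Q in IH.
move=> z z0; have Pz := IH z z0; have [lePz _] := stable_logderiv IH z0.
have zn : z != 0 by apply: Im_neq0; rewrite gt_eqF.
have aC : a%:C != 0 by rewrite fmorph_eq0 gt_eqF.
suff : (a%:C *: pochtr a%:C ((1 + k *: 'X) * Q)).[z] != 0.
  by rewrite hornerZ mulf_eq0 negb_or => /andP[].
rewrite pochtr_mul; last first.
  move=> j; rewrite -(rmorph_nat (real_complex R)) -rmorphD fmorph_eq0 gt_eqF //.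
  by rewrite ltr_wpDr ?ler0n.
rewrite -/P hornerD hornerN !hornerD !hornerZ !hornerM !hornerX; apply/eqP => e.
have : Im k = Im (a%:C * z^-1 + P^`().[z] / P.[z]).
  congr (Im _); apply/eqP; rewrite -subr_eq0 -(mulrI_eq0 _ (lregP zn)) -(mulrI_eq0 _ (lregP Pz)).
  rewrite -oppr_eq0 -[X in _ == X]e; apply/eqP; field.
  by rewrite Pz.
rewrite ImD Im_real => e2; have : a * Im z^-1 < 0 by rewrite pmulr_rlt0 // Im_inv_lt0.
by lra.
Qed.

End PochStable.

(** * Polynomials in the derivation acting on polynomials *)

Section DifferentialOperators.
Variable K : fieldType.
Implicit Types (r s f g : {poly K}) (c : K).

(* r(D) f, where D is the derivation. *)
Definition dact r f := \sum_(i < size r) r`_i *: f^`(i).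

Lemma dact_widen n r f : (size r <= n)%N -> dact r f = \sum_(i < n) r`_i *: f^`(i).
Proof.
move=> h; rewrite /dact (big_ord_widen _ (fun i => r`_i *: f^`(i)) h) big_mkcond /=.
apply: eq_bigr => i _; case: ltnP => // hi.
by rewrite nth_default // scale0r.
Qed.

Lemma dactDl r s f : dact (r + s) f = dact r f + dact s f.
Proof.
pose n := maxn (size r) (size s).
rewrite !(@dact_widen n) ?leq_maxl ?leq_maxr ?(leq_trans (size_polyD _ _)) //.
by rewrite -big_split; apply: eq_bigr => i _; rewrite coefD scalerDl.
Qed.

Lemma dactZl c r f : dact (c *: r) f = c *: dact r f.
Proof.
rewrite (@dact_widen (size r)) ?size_scale_leq // scaler_sumr.
by apply: eq_bigr => i _; rewrite coefZ scalerA.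
Qed.

Lemma dactC c f : dact c%:P f = c *: f.
Proof. by rewrite (@dact_widen 1) ?size_polyC_leq1 // big_ord1 coefC derivn0. Qed.

Lemma dact1 f : dact 1 f = f.
Proof. by rewrite -[1]/(1%:P) dactC scale1r. Qed.

Lemma dactN r f : dact (- r) f = - dact r f.
Proof. by rewrite -scaleN1r dactZl scaleN1r. Qed.

Lemma dactXl r f : dact (r * 'X) f = (dact r f)^`().
Proof.
rewrite (@dact_widen (size r).+1); last first.
  by rewrite (leq_trans (size_polyMleq _ _)) // size_polyX addnC.
rewrite big_ord_recl coefMX scale0r add0r raddf_sum /=.
by apply: eq_bigr => i _; rewrite coefMX /= derivZ -derivnS.
Qed.

Lemma dactDr r f g : dact r (f + g) = dact r f + dact r g.
Proof. by rewrite -big_split; apply: eq_bigr => i _; rewrite derivnD scalerDr. Qed.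

Lemma dactZr r c f : dact r (c *: f) = c *: dact r f.
Proof.
by rewrite scaler_sumr; apply: eq_bigr => i _; rewrite derivnZ !scalerA mulrC.
Qed.

Lemma dact0l f : dact 0 f = 0.
Proof. by rewrite -[0]/(0%:P) dactC scale0r. Qed.

Lemma dact0r r : dact r 0 = 0.
Proof. by rewrite -{1}(scale0r 0) dactZr scale0r. Qed.

Lemma dact_sum (I : Type) (rI : seq I) (P : pred I) (F : I -> {poly K}) f :
  dact (\sum_(i <- rI | P i) F i) f = \sum_(i <- rI | P i) dact (F i) f.
Proof. by apply: (big_morph (dact^~ f)) => [x y|]; rewrite ?dactDl ?dact0l. Qed.

Lemma dactM r s f : dact (r * s) f = dact r (dact s f).
Proof.
elim/poly_ind: r => [|r c IH]; first by rewrite mul0r !dact0l.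
rewrite mulrDl !dactDl mulrAC !dactXl IH; congr (_ + _).
by rewrite mul_polyC dactZl dactC.
Qed.

Lemma dactX f : dact 'X f = f^`().
Proof. by rewrite -['X]mul1r dactXl dact1. Qed.

Lemma dactXn n f : dact 'X^n f = f^`(n).
Proof.
elim: n => [|n IH]; first by rewrite expr0 dact1.
by rewrite exprSr dactXl IH -derivnS.
Qed.

End DifferentialOperators.

Lemma dact_map (K L : fieldType) (h : {rmorphism K -> L}) (r f : {poly K}) :
  map_poly h (dact r f) = dact (map_poly h r) (map_poly h f).
Proof.
rewrite (@dact_widen _ (size r) (map_poly h r)) ?size_map_poly // rmorph_sum.
by apply: eq_bigr => i _; rewrite /= map_polyZ derivn_map coef_map.
Qed.

(** * Stability under differential operators with constant coefficients *)

Section DifferentialStable.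
Variable R : rcfType.
Implicit Types (f : {poly R[i]}) (rs : seq R[i]).

Lemma coef_prod_XsubC_count0 (K : fieldType) (rs : seq K) i :
  (i < count_mem 0%R rs)%N -> (\prod_(r <- rs) ('X - r%:P))`_i = 0.
Proof.
elim: rs i => [|r rs IH] //= i; rewrite big_cons.
have [->|r0] := eqVneq r 0; rewrite /= ?add1n ?add0n => hi.
  by rewrite subr0 coefXM; case: i hi => //= i /IH.
rewrite mulrBl coefB coefXM mul_polyC coefZ (IH _ hi) mulr0 subr0.
by case: i hi => //= i hi; apply: IH; apply: ltnW.
Qed.

Lemma size_deriv_char0 f : size f^`() = (size f).-1.
Proof.
apply/anti_leq/andP; split.
  apply/leq_sizeP => j hj; rewrite coef_deriv nth_default ?mul0rn //.
  by rewrite (leq_trans (leqSpred _)).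
case e: (size f) => [|[|n]] //=; rewrite ltnNge; apply/negP => /leq_sizeP/(_ n (leqnn _)).
have : lead_coef f != 0 by rewrite lead_coef_eq0 -size_poly_eq0 e.
by rewrite lead_coefE e coef_deriv => h /eqP; rewrite mulrn_eq0 (negPf h).
Qed.

(** A factor with [r != 0] keeps the degree and is handled by [stable_deriv_sub]; a factor with
    [r = 0] is a plain derivative and lowers the degree by one, so the bound on the number of such
    factors keeps the result nonzero. *)
Lemma dact_stable f rs :
    {in rs, forall r, 0 <= Im r} -> stable f -> (count_mem 0%R rs < size f)%N ->
  stable (dact (\prod_(r <- rs) ('X - r%:P)) f).
Proof.
elim: rs f => [|r rs IH] f h sf hc; first by rewrite big_nil dact1.
rewrite big_cons mulrC dactM dactDl dactX -polyCN dactC scaleNr.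
have {}IH g : stable g -> (count_mem 0%R rs < size g)%N ->
    stable (dact (\prod_(r <- rs) ('X - r%:P)) g).
  by apply: IH => s srs; apply: h; rewrite inE srs orbT.
have [r0|r0] := eqVneq r 0; rewrite /= ?r0 ?eqxx ?(negPf r0) /= ?add1n ?add0n in hc *.
  rewrite scale0r subr0; apply: IH.
  - by apply: stable_deriv => //; apply: leq_ltn_trans hc.
  - by rewrite size_deriv_char0 ltn_predRL.
apply: IH.
- by apply: stable_deriv_sub => //; apply: h; rewrite mem_head.
have f0 : (0 < size f)%N by apply: leq_ltn_trans hc.
rewrite addrC size_polyDl size_polyN size_scale // size_deriv_char0.
by rewrite prednK.
Qed.

End DifferentialStable.

(** * Laguerre polynomials and their differential identities *)

Section Laguerre.
Variable K : numFieldType.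
Implicit Types (t be al x : K) (f : {poly K}).

Lemma natr_neq0 n : n.+1%:R != 0 :> K.
Proof. by rewrite pnatr_eq0. Qed.

Lemma factr_neq0 n : n`!%:R != 0 :> K.
Proof. by rewrite pnatr_eq0 -lt0n fact_gt0. Qed.

Definition gb t j := (\prod_(i < j) (t - i%:R)) / j`!%:R.

Lemma gb0 t : gb t 0 = 1.
Proof. by rewrite /gb big_ord0 fact0 divr1. Qed.

Lemma gbS t j : gb t j.+1 = gb t j * (t - j%:R) / j.+1%:R.
Proof.
rewrite /gb big_ord_recr /= factS natrM; field.
by rewrite factr_neq0 addrC natr1 natr_neq0.
Qed.

Lemma gb_pascal t j : gb (t + 1) j.+1 = gb t j.+1 + gb t j.
Proof.
elim: j => [|j IH]; first by rewrite !gbS !gb0 subr0 mul1r !divr1 mul1r subr0.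
rewrite gbS IH [gb t j.+2]gbS gbS -[j.+2%:R]nat1r -[j.+1%:R]nat1r.
have := natr_neq0 j.+1; have := natr_neq0 j; rewrite -[j.+2%:R]nat1r -[j.+1%:R]nat1r.
by move: (j%:R : K) => J h1 h2; field; rewrite h1 h2.
Qed.

Definition lag be n := \poly_(k < n.+1) (gb (n%:R + be) (n - k) * (-1) ^+ k / k`!%:R).

Lemma lag0 be : lag be 0 = 1.
Proof.
apply/polyP => -[|i]; rewrite coef_poly coef1 //=.
by rewrite gb0 expr0 fact0 divr1 mulr1.
Qed.

Lemma lag_deriv be n : (lag be n.+1)^`() = - lag (be + 1) n.
Proof.
apply/polyP => k; rewrite coefN coef_deriv !coef_poly ltnS.
case: ltnP => _; last by rewrite mul0rn oppr0.
rewrite subSS -natr1 -addrA [1 + be]addrC exprS -mulr_natr factS natrM; field.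
by rewrite factr_neq0 addrC natr1 natr_neq0.
Qed.

Lemma lag_subderiv be n : lag be n - (lag be n)^`() = lag (be + 1) n.
Proof.
case: n => [|n]; first by rewrite !lag0 -[1]/(1%:P) derivC subr0.
rewrite lag_deriv opprK; apply/polyP => k; rewrite coefD !coef_poly.
have -> : n%:R + (be + 1) = n.+1%:R + be by rewrite -natr1; ring.
rewrite addrA; have [kn|kn] := ltnP k n.+1.
  rewrite ltnS (ltnW kn) subSn // gb_pascal.
  by field; rewrite factr_neq0.
rewrite addr0; case: ltnP => // kn2.
have -> : k = n.+1 by apply/anti_leq; rewrite kn -ltnS kn2.
by rewrite subnn !gb0.
Qed.

(** Lowers the degree at the price of higher parameters, which is what the induction step of
    [lop_lag] needs. *)
Lemma lag_rec be n : n.+1%:R *: lag be n.+1 =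
  (be + 1) *: lag (be + 1) n - 'X * lag (be + 2) n.
Proof.
apply/polyP => k; rewrite coefB !coefZ coefXM !coef_poly.
have -> : n%:R + (be + 2) = n.+1%:R + be + 1 by rewrite -natr1; ring.
have -> : n%:R + (be + 1) = n.+1%:R + be by rewrite -natr1; ring.
have [kn|kn] := ltnP k n.+1; last first.
  rewrite mulr0 sub0r; case: k kn => //= k kn; rewrite !ltnS.
  case: leqP => // kn2; last by rewrite mulr0 oppr0.
  have -> : k = n by apply/anti_leq; rewrite kn2 -ltnS kn.
  rewrite !subnn !gb0 exprS factS natrM; field.
  by rewrite factr_neq0 addrC natr1 natr_neq0.
have [j def_n] : exists j, n = (j + k)%N by exists (n - k)%N; rewrite subnK.
have -> : (n.+1 - k = j.+1)%N by rewrite def_n -addSn addnK.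
have -> : (n - k = j)%N by rewrite def_n addnK.
rewrite ltnS (ltnW kn) gbS; case: k kn def_n => [|k] kn def_n /=.
  rewrite def_n addn0 subr0 expr0 fact0 divr1 -!natr1; field.
  by rewrite natr1 natr_neq0.
have -> : (n - k = j.+1)%N by rewrite def_n addnS -addSn addnK.
rewrite ltnW // gb_pascal gbS def_n factS natrM exprS -!natr1 natrD -natr1.
have := natr_neq0 j; have := natr_neq0 k; have := factr_neq0 k; rewrite -!natr1.
move: (j%:R : K) (k%:R : K) (k`!%:R : K) => J L F h1 h2 h3.
by field; rewrite h1 h2 h3.
Qed.

Definition lop_coef (a : K) k j : K := 'C(k, j)%:R / poch a j.

Lemma dact_lag be n j k :
  dact ((1 - 'X) ^+ j * 'X^k) (lag be n) =
  if (k <= n)%N then (-1) ^+ k *: lag (be + k%:R + j%:R) (n - k) else 0.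
Proof.
rewrite dactM dactXn.
have h1 : (lag be n)^`(k) = if (k <= n)%N then (-1) ^+ k *: lag (be + k%:R) (n - k) else 0.
  elim: k be n => [|k IH] be n; first by rewrite derivn0 subn0 addr0 expr0 scale1r.
  rewrite derivSn; case: n => [|n].
    by rewrite lag0 -[1]/(1%:P) derivC linear0.
  rewrite lag_deriv derivnN IH ltnS subSS; case: leqP => _; last by rewrite oppr0.
  by rewrite -scaleNr exprS mulN1r -natr1; congr (_ *: lag _ _); ring.
rewrite h1; case: leqP => _; last by rewrite dact0r.
rewrite dactZr; congr (_ *: _).
elim: j => [|j IH]; first by rewrite expr0 dact1 addr0.
rewrite exprS dactM IH dactDl dact1 dactN dactX.
by rewrite lag_subderiv -natr1; congr (lag _ _); ring.
Qed.

(** Pascal-like recurrence matching the one that [lag_rec] produces; it reduces to [(k - j)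
    binom(k,j) = (j + 1) binom(k,j+1)]. *)
Lemma lop_lag_rec al k j (cf := fun k j => poch (al + 1) k / k`!%:R * lop_coef (al + 1) k j) :
    (forall j, al + 1 + j%:R != 0) ->
  k.+1%:R * cf k.+1 j = cf k j * (al + k%:R + j%:R + 1) + (if j is j'.+1 then cf k j' else 0).
Proof.
move=> ha; have pn i : poch (al + 1) i != 0 by apply/prodf_neq0 => ? _.
rewrite /cf /lop_coef pochS factS natrM; case: j => [|j].
  rewrite !bin0 poch0 -natr1; field.
  by rewrite factr_neq0 natr1 natr_neq0.
have := mul_bin_left k j; rewrite binS natrD pochS.
have [jk|jk] := leqP j k; last first.
  rewrite !bin_small ?(leqW jk) // => _; ring.
move=> /(congr1 (fun n => n%:R : K)); rewrite !natrM natrB // -!natr1.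
have := ha j; have := pn j; have := natr_neq0 k; have := factr_neq0 k; rewrite -!natr1.
move: ('C(k, j)%:R : K) ('C(k, j.+1)%:R : K) (j%:R : K) (k%:R : K) (k`!%:R : K) => B B' J L F h1 h2 h3 h4 e.
apply/eqP; rewrite -subr_eq0; apply/eqP.
transitivity (poch (al + 1) k / F / (poch (al + 1) j * (al + 1 + J)) * ((L - J) * B - (J + 1) * B')).
  by field; rewrite h1 h2 h3 h4.
by rewrite -e subrr mulr0.
Qed.

(** Eigenvalue identity for the [k]-th summand of [T], by induction on [k]: after multiplication by
    [n - k], each Laguerre polynomial is rewritten by [lag_rec], and collecting equal powers of [x]
    gives the recurrence [lop_lag_rec]. *)
Lemma lop_lag al n k : (forall j, al + 1 + j%:R != 0) -> (k <= n)%N ->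
  \sum_(j < k.+1) (poch (al + 1) k / k`!%:R * lop_coef (al + 1) k j) *:
    ((- 'X) ^+ j * lag (al + k%:R + j%:R) (n - k)) = 'C(n, k)%:R *: lag al n.
Proof.
move=> ha; elim: k => [|k IH] kn.
  by rewrite big_ord1 /lop_coef !poch0 fact0 !bin0 !divr1 mul1r !scale1r expr0 mul1r !addr0 subn0.
have := IH (ltnW kn); set cf := fun k j => poch (al + 1) k / k`!%:R * lop_coef (al + 1) k j.
rewrite -[\sum_(j < k.+1) _]/(\sum_(j < k.+1) cf k j *: _).
rewrite -[\sum_(j < k.+2) _]/(\sum_(j < k.+2) cf k.+1 j *: _).
move=> /(congr1 (fun f => (n - k)%:R *: f)); rewrite scalerA -natrM.
rewrite -mul_bin_left natrM -scalerA => e.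
apply: (scalerI (natr_neq0 k)); rewrite -{}e !scaler_sumr.
pose W j := (- 'X) ^+ j * lag (al + k.+1%:R + j%:R) (n - k.+1).
transitivity (\sum_(j < k.+2) (cf k j * (al + k%:R + j%:R + 1) +
    (if (j : nat) is j'.+1 then cf k j' else 0)) *: W j).
  by apply: eq_bigr => j _; rewrite scalerA /cf lop_lag_rec.
under eq_bigr do rewrite scalerDl.
rewrite big_split big_ord_recr /= [in X in _ + X]big_ord_recl scale0r add0r.
rewrite {2}/cf /lop_coef bin_small // !mul0r mulr0 !mul0r scale0r addr0 -big_split.
apply: eq_bigr => j _ /=; rewrite /bump /= add1n.
have -> : (n - k = (n - k.+1).+1)%N by rewrite subnSK.
rewrite add0n [RHS]scalerA [RHS](_ : _ = cf k j *: ((- 'X) ^+ j * ((n - k.+1).+1%:R *: lag (al + k%:R + j%:R) (n - k.+1).+1))); last first.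
  by rewrite -scalerAr scalerA mulrC.
rewrite lag_rec.
rewrite mulrBr scalerBr -scalerAr scalerA; congr (_ + _).
  by rewrite /W -natr1; congr (_ *: (_ * lag _ _)); ring.
rewrite -scalerN /W exprSr mulrN mulNr mulrA; congr (_ *: - (_ * lag _ _)).
by rewrite -!natr1; ring.
Qed.

End Laguerre.

(** * The operator [T] and its symbol *)

Section Operator.
Variable K : numFieldType.
Implicit Types (a x y : K) (b : nat -> K) (f : {poly K}).

(* The differential operator T of the header, truncated to k < M; lop_eigen identifies it. *)
Definition lop a b M f : {poly K} := \sum_(k < M) \sum_(j < k.+1)
  ((-1) ^+ k * b k * lop_coef a k j) *: ((- 'X) ^+ j * dact ((1 - 'X) ^+ j * 'X^k) f).

(* F_x(y): the symbol of T with D replaced by y. *)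
Definition lsym a b M x : {poly K} := \sum_(k < M) \sum_(j < k.+1)
  ((-1) ^+ k * b k * lop_coef a k j * (- x) ^+ j) *: ((1 - 'X) ^+ j * 'X^k).

Lemma horner_lop a b M f x : (lop a b M f).[x] = (dact (lsym a b M x) f).[x].
Proof.
rewrite /lop /lsym dact_sum !horner_sum; apply: eq_bigr => k _.
rewrite dact_sum !horner_sum; apply: eq_bigr => j _.
by rewrite dactZl !hornerZ hornerM horner_exp hornerN hornerX mulrA.
Qed.

Lemma eq_lop a a' b b' M f : a = a' -> b =1 b' -> lop a b M f = lop a' b' M f.
Proof.
by move=> -> e; apply: eq_bigr => k _; apply: eq_bigr => j _; rewrite e.
Qed.

Lemma lopD a b M f g : lop a b M (f + g) = lop a b M f + lop a b M g.
Proof.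
rewrite -big_split; apply: eq_bigr => k _; rewrite -big_split; apply: eq_bigr => j _.
by rewrite dactDr mulrDr scalerDr.
Qed.

Lemma lopZ a b M c f : lop a b M (c *: f) = c *: lop a b M f.
Proof.
rewrite scaler_sumr; apply: eq_bigr => k _; rewrite scaler_sumr; apply: eq_bigr => j _.
by rewrite dactZr -scalerAr !scalerA mulrC.
Qed.

Lemma lop0 a b M : lop a b M 0 = 0.
Proof. by rewrite -(scale0r 0) lopZ !scale0r. Qed.

Lemma lop_sum a b M (I : Type) (r : seq I) (P : pred I) (F : I -> {poly K}) :
  lop a b M (\sum_(i <- r | P i) F i) = \sum_(i <- r | P i) lop a b M (F i).
Proof. exact: (big_morph _ (lopD a b M) (lop0 a b M)). Qed.

(** Summands with [k > n] annihilate degree [n], so truncation at any [M > n] already yields the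
    full eigenvalue. *)
Lemma lop_eigen al c M n : (forall j, al + 1 + j%:R != 0) ->
  lop (al + 1) (fun k => poch (al + 1) k / k`!%:R * c k) M (lag al n) =
  (\sum_(k < M) c k * 'C(n, k)%:R) *: lag al n.
Proof.
move=> ha; rewrite scaler_suml; apply: eq_bigr => k _.
have [kn|kn] := leqP k n; last first.
  rewrite bin_small // mulr0 scale0r big1 // => j _.
  by rewrite dact_lag leqNgt kn mulr0 scaler0.
rewrite -scalerA -lop_lag // scaler_sumr; apply: eq_bigr => j _.
rewrite dact_lag kn -scalerAr !scalerA; congr (_ *: _).
rewrite mulrC !mulrA -exprMn mulrN1 opprK expr1n; ring.
Qed.

Lemma pochtrD a (p q : {poly K}) : pochtr a (p + q) = pochtr a p + pochtr a q.
Proof.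
by apply/polyP => i; rewrite coefD !coef_pochtr coefD mulrDr mulrDl.
Qed.

Lemma pochtrZ a c (p : {poly K}) : pochtr a (c *: p) = c *: pochtr a p.
Proof.
by apply/polyP => i; rewrite coefZ !coef_pochtr coefZ; ring.
Qed.

Lemma pochtr0 a : pochtr a 0 = 0.
Proof. by rewrite -(scale0r 0) pochtrZ !scale0r. Qed.

Lemma pochtr_expr a c k x : (pochtr a ((1 + c *: 'X) ^+ k)).[x] =
  \sum_(j < k.+1) lop_coef a k j * (- x) ^+ j * c ^+ j.
Proof.
rewrite exprDn (big_morph _ (pochtrD a) (pochtr0 a)) horner_sum; apply: eq_bigr => j _.
rewrite expr1n mul1r exprZn -scaler_nat scalerA pochtrZ hornerZ.
have -> : pochtr a 'X^j = ((-1) ^+ j / poch a j) *: 'X^j.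
  apply/polyP => i; rewrite coef_pochtr coefZ !coefXn.
  by case: eqP => [->|_]; rewrite ?mulr1 // !mulr0 mul0r.
rewrite hornerZ hornerXn /lop_coef (exprNn x); ring.
Qed.

(** Since [y^k (1 + (1 - y) X)^k = (y + y (1 - y) X)^k], the symbol is the transform of
    [q (y + y (1 - y) X)] with [q u = p (- u)], so a factorization of [q] yields linear factors in
    [X] under the transform. *)
Lemma horner_lsym a b M x y : (lsym a b M x).[y] =
  (pochtr a (\sum_(k < M) ((-1) ^+ k * b k) *: (y%:P + (y * (1 - y)) *: 'X) ^+ k)).[x].
Proof.
rewrite (big_morph _ (pochtrD a) (pochtr0 a)) !horner_sum; apply: eq_bigr => k _.
have -> : y%:P + (y * (1 - y)) *: 'X = y *: (1 + (1 - y) *: 'X).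
  by rewrite scalerDr scalerA alg_polyC.
rewrite exprZn scalerA pochtrZ hornerZ pochtr_expr horner_sum mulr_sumr.
apply: eq_bigr => j _; rewrite hornerZ hornerM hornerXn horner_exp hornerD hornerN hornerX.
by rewrite hornerC; ring.
Qed.

(** Terms with [k > m] are divisible by higher powers of [y], and [1 - y] is 1 at [y = 0]. *)
Lemma coef_lsym a b M x m : (m < M)%N -> (forall k, (k < m)%N -> b k = 0) ->
  (lsym a b M x)`_m = (-1) ^+ m * b m * (pochtr a ((1 + 'X) ^+ m)).[x].
Proof.
move=> mM hb; rewrite coef_sum (bigD1 (Ordinal mM)) //= [X in _ + X]big1 ?addr0; last first.
  move=> k km; rewrite coef_sum big1 // => j _; rewrite coefZ coefMXn.
  case: (ltngtP k m) => [/hb->||/eqP]; rewrite ?mulr0 ?mul0r //.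
  by rewrite -[(_ == _ :> nat)]/(k == Ordinal mM) (negPf km).
rewrite -['X in RHS]scale1r pochtr_expr coef_sum mulr_sumr; apply: eq_bigr => j _.
rewrite coefZ coefMXn ltnn subnn -horner_coef0 horner_exp hornerD hornerN hornerX hornerC.
by rewrite subr0 !expr1n; ring.
Qed.

End Operator.

Lemma lop_map (K L : numFieldType) (h : {rmorphism K -> L}) a b M f :
  map_poly h (lop a b M f) = lop (h a) (h \o b) M (map_poly h f).
Proof.
rewrite rmorph_sum; apply: eq_bigr => k _; rewrite rmorph_sum; apply: eq_bigr => j _.
rewrite /= map_polyZ; congr (_ *: _).
  rewrite /lop_coef !rmorphM rmorphXn rmorphN1 fmorphV rmorph_nat /poch rmorph_prod.
  by congr (_ * (_ * _^-1)); apply: eq_bigr => i _; rewrite rmorphD rmorph_nat.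
rewrite rmorphM rmorphXn rmorphN /= map_polyX dact_map.
by rewrite rmorphM !rmorphXn rmorphB rmorph1 /= map_polyX.
Qed.

(** * Sufficiency: zeros between -1 and 0 give preservation of real-rootedness *)

Section Sufficiency.
Variable R : rcfType.
Local Notation toC := (map_poly (real_complex R)).

(** The quotient is the coefficient [kappa] in [y - s + y (1 - y) X = (y - s) (1 + kappa X)]. The
    location of the zeros of [p] enters through the sign of [s (1 - s)]. *)
Lemma Im_kappa (y : R[i]) (s : R) : Im y < 0 -> 0 <= s <= 1 ->
  0 <= Im (y * (1 - y) / (y - s%:C)).
Proof.
move=> y0 /andP[s0 s1]; rewrite Im_div divr_ge0 ?nsq_ge0 //; case: y y0 => u v /= v0.
have -> : (u * (1 - u) - v * (0 - v)) * - (v - 0) + (u * (0 - v) + v * (1 - u)) * (u - s)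
  = - v * ((u - s) ^+ 2 + v ^+ 2 + s * (1 - s)) by ring.
by rewrite mulr_ge0 ?oppr_ge0 ?(ltW v0) // !addr_ge0 ?sqr_ge0 ?mulr_ge0 ?subr_ge0.
Qed.

Variables (a : R) (b : nat -> R) (M : nat) (c : R) (ss : seq R).
Hypothesis a0 : 0 < a.
Hypothesis qE : \poly_(k < M) ((-1) ^+ k * b k) = c *: \prod_(s <- ss) ('X - s%:P).
Hypothesis ss01 : {in ss, forall s, 0 <= s <= 1}.

Lemma lsym_neq0 (x y : R[i]) : c != 0 -> 0 < Im x -> Im y < 0 ->
  (lsym a%:C (real_complex R \o b) M x).[y] != 0.
Proof.
move=> c0 x0 y0; rewrite horner_lsym.
set Q := (X in pochtr _ X).
have ys s : y - s%:C != 0 by apply: Im_neq0; rewrite ImD ImN /= subr0 lt_eqF.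
have -> : Q = (c%:C * \prod_(s <- ss) (y - s%:C)) *:
    \prod_(k <- [seq y * (1 - y) / (y - s%:C) | s <- ss]) (1 + k *: 'X).
  have -> : Q = toC (\poly_(k < M) ((-1) ^+ k * b k)) \Po (y%:P + (y * (1 - y)) *: 'X).
    rewrite comp_polyE (big_ord_widen M (fun i => (toC _)`_i *: _ ^+ i)); last first.
      by rewrite size_map_poly size_poly.
    rewrite [RHS]big_mkcond; apply: eq_bigr => i _.
    rewrite coef_map coef_poly ltn_ord /= rmorphM rmorphXn rmorphN1.
    case: ltnP => //; rewrite size_map_poly => /(nth_default 0).
    rewrite coef_poly ltn_ord => /(congr1 (real_complex R)).
    by rewrite rmorph0 rmorphM rmorphXn rmorphN1 => ->; rewrite scale0r.
  rewrite qE map_polyZ comp_polyZ !rmorph_prod /= -[RHS]scalerA; congr (_ *: _).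
  rewrite big_map -scaler_prod; apply: eq_bigr => s _.
  rewrite rmorphB /= map_polyX map_polyC /= comp_polyB comp_polyX comp_polyC.
  by rewrite scalerDr scalerA mulrCA divff // mulr1 alg_polyC polyCB addrAC.
rewrite pochtrZ hornerZ mulf_neq0 //.
  rewrite mulf_neq0 ?fmorph_eq0 // prodf_seq_neq0.
  by apply/allP => s _; rewrite /= ys.
apply: pochtr_stable => // k /mapP[s sss ->]; apply: Im_kappa => //.
exact: ss01.
Qed.

(** With [m] the least index of a nonzero coefficient, [T] kills degrees below [m]. For other
    nonzero [f], the roots of the symbol have nonnegative imaginary part and 0 occurs at most [m]
    times, as [dact_stable] requires. *)
Lemma rr_lop f : rr f -> rr (lop a b M f).
Proof.
have [c0|c0] := eqVneq c 0.
  move=> _; suff -> : lop a b M f = 0 by apply: rr0.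
  rewrite /lop big1 // => k _; rewrite big1 // => j _.
  suff -> : b k = 0 by rewrite mulr0 mul0r scale0r.
  have := congr1 (fun p : {poly R} => p`_k) qE.
  rewrite c0 scale0r coef0 coef_poly ltn_ord => /eqP.
  by rewrite mulf_eq0 signr_eq0 => /eqP.
have bn0 : exists m, (m < M)%N && (b m != 0).
  have : lead_coef (\poly_(k < M) ((-1) ^+ k * b k)) != 0.
    by rewrite qE lead_coefZ (monicP (monic_prod_XsubC _ _ _)) mulr1.
  set n := (size (\poly_(k < M) ((-1) ^+ k * b k))).-1.
  rewrite lead_coefE coef_poly -/n; case: ifP => [nM|]; last by rewrite eqxx.
  by rewrite mulf_eq0 signr_eq0 => nb; exists n; rewrite nM.
case: (ex_minnP bn0) => m /andP[mM bm] m_min.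
have bm0 k : (k < m)%N -> b k = 0.
  move=> km; apply/eqP; apply: contraLR (km) => bk.
  by rewrite -leqNgt m_min // bk (ltn_trans km mM).
case/rr_stable => [->|sf]; first by rewrite lop0; apply: rr0.
have [fm|fm] := leqP (size f) m.
  suff -> : lop a b M f = 0 by apply: rr0.
  rewrite /lop big1 // => k _; rewrite big1 // => j _.
  have [km|km] := ltnP k m; first by rewrite bm0 // mulr0 mul0r scale0r.
  rewrite dactM dactXn derivn_poly0 ?(leq_trans fm) //.
  by rewrite dact0r mulr0 scaler0.
apply: stable_rr => x x0; rewrite lop_map horner_lop.
set F := lsym _ _ _ _; have [rs FE] := poly_factor F.
have F0 : lead_coef F != 0.
  rewrite lead_coef_eq0; apply/eqP => F0.
  have hi : Im (- 'i%C : R[i]) < 0 by rewrite /= oppr_lt0 ltr01.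
  by have := lsym_neq0 c0 x0 hi; rewrite -/F F0 horner0 eqxx.
have hrs : {in rs, forall r, 0 <= Im r}.
  move=> r rrs; rewrite leNgt; apply/negP => r0.
  have := @lsym_neq0 x r c0 x0 r0; rewrite -/F FE hornerZ horner_prod_XsubC.
  by rewrite (big_rem r rrs) /= subrr mul0r mulr0 eqxx.
rewrite FE dactZl hornerZ mulf_neq0 //.
apply: dact_stable => //; rewrite size_map_poly.
rewrite ltnNge; apply/negP => hc.
have : F`_m = 0.
  by rewrite FE coefZ coef_prod_XsubC_count0 ?mulr0 // (leq_trans fm).
(* The transform of [(1 + X)^m] is stable, so the coefficient of index [m] of the symbol is
   nonzero. *)
rewrite coef_lsym // => [|k /bm0 /= ->]; last by rewrite rmorph0.
apply/eqP; rewrite !mulf_neq0 ?signr_eq0 //= ?fmorph_eq0 //.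
have -> : (1 + 'X) ^+ m = \prod_(k <- nseq m (1 : R[i])) (1 + k *: 'X).
  by rewrite big_nseq scale1r iter_mulr_1.
apply: pochtr_stable => // k; rewrite mem_nseq => /andP[_ /eqP ->] //=.
Qed.

End Sufficiency.

(** * Real parts of polynomials, passage to limits, and bounds from the roots *)

Section RealParts.
Variable R : rcfType.
Implicit Types (p q h : {poly R[i]}) (z w : R[i]) (x y t : R).
Local Notation toC := (map_poly (real_complex R)).

Definition Rep p : {poly R} := \poly_(i < size p) Re p`_i.
Definition conjp p : {poly R[i]} := map_poly conjc p.

Lemma coef_Rep p i : (Rep p)`_i = Re p`_i.
Proof. by rewrite coef_poly; case: ltnP => // /(nth_default 0) ->. Qed.

Lemma horner_Rep p t : (Rep p).[t] = Re p.[t%:C].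
Proof.
rewrite horner_poly horner_coef Re_sum; apply: eq_bigr => i _.
by rewrite -rmorphXn mulrC [in RHS]mulrC Re_real.
Qed.

Lemma horner_conjp p z : (conjp p).[z] = conjc p.[conjc z].
Proof. by rewrite -{1}[z]conjcK horner_map. Qed.

Lemma toC_Rep p : toC (Rep p) = 2^-1 *: (p + conjp p).
Proof.
apply/polyP => i; rewrite coef_map /= coef_Rep coefZ coefD coef_map /=.
case: p`_i => u v; apply/eqP; rewrite eq_complex /=.
by apply/andP; split; apply/eqP; field.
Qed.

(** Restriction to a real line turns comparisons of moduli into statements on real polynomials, open
    to continuity and the intermediate value theorem. *)
Lemma nsq_poly p z w : exists g : {poly R}, forall t, g.[t] = nsq p.[z + t%:C * w].
Proof.
pose P := p \Po (z%:P + w *: 'X); exists (Rep (P * conjp P)) => t.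
rewrite horner_Rep hornerM horner_conjp conjc_real mulcJ /=.
by rewrite horner_comp hornerD hornerC hornerZ hornerX mulrC.
Qed.

Lemma poly_ge0_limit (g : {poly R}) :
  (forall d, 0 < d -> exists e, [/\ 0 < e, e < d & 0 <= g.[e]]) -> 0 <= g.[0].
Proof.
move=> h; rewrite leNgt; apply/negP => g0.
have ng0 : 0 < - g.[0] by rewrite oppr_gt0.
have [d d0 hd] := poly_cont 0 g ng0.
have [e [e0 ed ge]] := h d d0.
have := hd e; rewrite subr0 gtr0_norm // ltr_norml opprK => /(_ ed)/andP[_].
lra.
Qed.

Lemma poly_same_sign (g : {poly R}) :
  (forall t, 0 <= t <= 1 -> g.[t] != 0) -> 0 < g.[0] * g.[1].
Proof.
move=> h; rewrite ltNge; apply/negP => g01.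
have [t t01 /eqP gt] := polyrcf.poly_ivt ler01 g01.
by have := h t t01; rewrite gt eqxx.
Qed.

(** Each factor satisfies [|z - r| >= Im z]. Unlike mere nonvanishing, this bound survives limits,
    so it replaces the theorem of Hurwitz. *)
Lemma stable_lower_bound p z : stable p -> 0 < Im z ->
  nsq (lead_coef p) * Im z ^+ 2 ^+ (size p).-1 <= nsq p.[z].
Proof.
move=> sp z0; have [rs pE] := poly_factor p; have hrs := stable_roots sp pE.
have [p0|p0] := eqVneq (lead_coef p) 0.
  by rewrite p0 nsq_real expr0n mul0r nsq_ge0.
have -> : (size p).-1 = size rs.
  by rewrite pE size_scale // size_prod_XsubC.
rewrite {2}pE hornerZ nsqM ler_wpM2l ?nsq_ge0 // horner_prod_XsubC.
elim: rs {pE} hrs => [|r rs IH] hrs; first by rewrite expr0 big_nil nsq_real expr1n.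
rewrite /= exprS big_cons nsqM ler_pM ?exprn_ge0 // ?(ltW z0) //; last first.
  by apply: IH => s srs; apply: hrs; rewrite inE srs orbT.
have hr := hrs r (mem_head _ _).
rewrite /nsq ImD ImN; have := sqr_ge0 (Re (z - r)).
nra.
Qed.

(** The index [d] is fixed while the degree may drop, so the bound is uniform over a family of
    polynomials. *)
Lemma stable_coef_bound p z d : stable p -> (size p <= d.+1)%N -> 0 < Im z ->
  nsq p`_d * Im z ^+ 2 ^+ d <= nsq p.[z].
Proof.
move=> sp szp z0; have [p0|p0] := eqVneq p`_d 0.
  by rewrite p0 nsq_real expr0n mul0r nsq_ge0.
have sE : size p = d.+1.
  by apply/anti_leq; rewrite szp ltnNge; apply: contraNN p0 => /leq_sizeP ->.
by have := stable_lower_bound sp z0; rewrite lead_coefE sE.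
Qed.

(** One half of the Hermite-Biehler theorem: every root lies strictly below the real axis, hence
    closer to [conjc z] than to [z]. *)
Lemma hermite_biehler h z : (forall z, 0 <= Im z -> h.[z] != 0) -> (1 < size h)%N ->
  0 < Im z -> nsq h.[conjc z] < nsq h.[z].
Proof.
move=> hh sh z0; have [rs hE] := poly_factor h.
have hrs : {in rs, forall r, Im r < 0}.
  move=> r rrs; rewrite ltNge; apply/negP => /hh.
  by rewrite hE hornerZ horner_prod_XsubC (big_rem r rrs) /= subrr mul0r mulr0 eqxx.
have h0 : lead_coef h != 0 by rewrite lead_coef_eq0 -size_poly_gt0 ltnW.
move: sh; rewrite {1}hE size_scale // size_prod_XsubC ltnS => sh.
rewrite hE !hornerZ !horner_prod_XsubC !nsqM ltr_pM2l ?nsq_gt0 //.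
rewrite !nsq_prod big_seq [ltRHS]big_seq ltr_prod //.
  by case: rs sh {hrs hE} => //= r rs _; rewrite mem_head.
move=> r rrs; rewrite nsq_ge0 /nsq !ReD !ImD ReJ ImJ ReN ImN ltrD2l /=.
by have := hrs r rrs; nra.
Qed.

End RealParts.

(** * A Newton inequality and real parts of zero-free polynomials *)

Section RealRootedMore.
Variable R : rcfType.
Implicit Types (p q : {poly R}) (c : R).
Local Notation toC := (map_poly (real_complex R)).

Lemma rrZ c p : rr p -> rr (c *: p).
Proof. by move=> [d [rs ->]]; exists (c * d), rs; rewrite scalerA. Qed.

Lemma rrC c : rr c%:P.
Proof. by exists c, [::]; rewrite big_nil alg_polyC. Qed.

Lemma rr_derivn n p : rr p -> rr p^`(n).
Proof. by elim: n => // n IH /IH; rewrite derivnS; apply: rr_deriv. Qed.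

(** A weak Newton inequality. Adding a root [r] replaces the defect [d = P_1^2 - 2 P_0 P_2] by
    [P_0^2 + r^2 d]. *)
Lemma rr_newton p : rr p -> 2 * (p`_0 * p`_2) <= p`_1 ^+ 2.
Proof.
move=> [c [rs ->]]; rewrite !coefZ.
set P := \prod_(r <- rs) _; suff : 2 * (P`_0 * P`_2) <= P`_1 ^+ 2.
  by move=> h; have := ler_wpM2l (sqr_ge0 c) h; nra.
rewrite {}/P; elim: rs => [|r rs IH]; first by rewrite big_nil !coef1 /= mulr0 mulr0 sqr_ge0.
rewrite big_cons mulrBl !coefB !coefXM !mul_polyC !coefZ /=.
move: IH; set P := \prod_(r <- rs) _ => IH.
have := ler_wpM2l (sqr_ge0 r) IH; have := sqr_ge0 (P`_0); nra.
Qed.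

Lemma rr_vanish p (z : R[i]) : rr p -> 0 < Im z -> (toC p).[z] = 0 -> p = 0.
Proof. by move=> /rr_stable[//|sp] z0 pz; have := sp z z0; rewrite pz eqxx. Qed.

(** At a zero [z] in the upper half plane [h] and its conjugate would cancel, so [h] would have
    equal moduli at [z] and [conjc z], against [hermite_biehler]. *)
Lemma rr_Rep (h : {poly R[i]}) : (forall z, 0 <= Im z -> h.[z] != 0) -> rr (Rep h).
Proof.
move=> hh; have [sh|sh] := leqP (size h) 1.
  rewrite (size1_polyC (_ : (size (Rep h) <= 1)%N)); first exact: rrC.
  by rewrite (leq_trans (size_poly _ _)).
apply: stable_rr => z z0; rewrite toC_Rep hornerZ hornerD horner_conjp.
rewrite mulf_neq0 ?invr_eq0 ?pnatr_eq0 // addr_eq0; apply/eqP => e.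
by have := hermite_biehler hh sh z0; rewrite e nsqN nsqJ ltxx.
Qed.

Lemma lag_coef_neq0 (be : R) n k : -1 < be -> (k <= n)%N -> (lag be n)`_k != 0.
Proof.
move=> hbe kn; rewrite coef_poly ltnS kn !mulf_neq0 ?signr_eq0 ?invr_eq0 ?factr_neq0 //.
apply/prodf_neq0 => i _; rewrite gt_eqF // subr_gt0.
have : (i : nat)%:R + 1 <= n%:R :> R.
  by rewrite natr1 ler_nat (leq_trans (ltn_ord i)) // leq_subr.
lra.
Qed.

End RealRootedMore.

(** * Images of the powers [(X + w)^N] for a fixed degree bound *)

Section FixedDegree.
Variables (R : rcfType) (a : R) (b lam : nat -> R) (N k l : nat).
Local Notation toC := (map_poly (real_complex R)).
Local Notation T := (lop a b N.+1).
Local Notation TC := (lop a%:C (real_complex R \o b) N.+1).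
Hypothesis a0 : 0 < a.
Hypothesis T_rr : forall f : {poly R}, (size f <= N.+1)%N -> rr f -> rr (T f).
Hypothesis T_lag : forall n, (n <= N)%N -> T (lag (a - 1) n) = lam n *: lag (a - 1) n.
Hypothesis kl : (k.+1 < l)%N.
Hypothesis lN : (l <= N)%N.
Hypothesis lamk : lam k != 0.
Hypothesis laml : lam l != 0.

Lemma toC_T f : toC (T f) = TC (toC f).
Proof. exact: lop_map. Qed.

(* Otherwise D^k (T (L_l + t L_k)) would be real-rooted for all t, against Newton's inequality
   for the lowest coefficients 2 r_0 r_2 <= r_1^2: only r_0 depends on t. *)
Lemma lop_nondegenerate : ~ (forall r : {poly R}, (size r <= N.+1)%N -> rr (T r)).
Proof.
have ha : -1 < a - 1 by rewrite ltrBrDr addNr.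
have kN : (k <= N)%N by rewrite (leq_trans _ lN) // ltnW // ltnW.
move=> h; pose f t := lag (a - 1) l + t *: lag (a - 1) k.
have hf t : rr ((lam l *: lag (a - 1) l + (t * lam k) *: lag (a - 1) k)^`(k)).
  apply: rr_derivn; rewrite -scalerA -!T_lag // -lopZ -lopD; apply: h.
  rewrite (leq_trans (size_polyD _ _)) // geq_max (leq_trans (size_poly _ _)) ?ltnS //=.
  by rewrite (leq_trans (size_scale_leq _ _)) // (leq_trans (size_poly _ _)).
have lagk i : (lag (a - 1) k)`_(k + i.+1) = 0.
  by rewrite nth_default // (leq_trans (size_poly _ _)) // addnS ltnS leq_addr.
pose L i := (lag (a - 1) l)`_(k + i) *+ (k + i) ^_ k.
pose g2 := lam l * L 2; pose g1 := lam l * L 1; pose g0 := lam l * L 0.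
pose D := lam k * ((lag (a - 1) k)`_k *+ k ^_ k).
have D0 : D != 0.
  by rewrite mulf_neq0 // mulrn_eq0 negb_or lag_coef_neq0 // ffactnn -lt0n fact_gt0.
(* The gap [k + 2 <= l] makes the coefficient of index [k + 2] nonzero. *)
have g20 : g2 != 0.
  rewrite mulf_neq0 // mulrn_eq0 negb_or lag_coef_neq0 ?addn2 // andbT.
  by rewrite -lt0n ffact_gt0 -addn2 leq_addr.
(* With this [t] the constant coefficient is [(g1^2 + 1) / (2 g2)], which violates the Newton
   inequality by exactly 1. *)
pose t := ((g1 ^+ 2 + 1) / (2 * g2) - g0) / D.
have := rr_newton (hf t); rewrite !coef_derivn !coefD !coefZ !lagk !mulr0 !addr0 !addn0.
have -> : (lam l * (lag (a - 1) l)`_k + t * lam k * (lag (a - 1) k)`_k) *+ k ^_ k = g0 + t * D.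
  by rewrite mulrnDl /g0 /L /D addn0 !mulrnAr mulrA.
rewrite -!mulrnAr -/(L 1) -/(L 2) -/g1 -/g2.
have -> : g0 + t * D = (g1 ^+ 2 + 1) / (2 * g2) by rewrite /t; field; rewrite D0 g20.
have -> : 2 * ((g1 ^+ 2 + 1) / (2 * g2) * g2) = g1 ^+ 2 + 1 by field.
lra.
Qed.

(** Ensures that a small multiple of [r] added to [(X + w)^N] creates no zero in the closed upper
    half plane. There [|z + w| >= Im w], so both 1 and [|z|] are bounded by multiples of
    [|z + w|]. *)
Lemma poly_domination (w : R[i]) n (r : {poly R[i]}) : 0 < Im w -> (size r <= n.+1)%N ->
  exists2 c, 0 <= c & forall z, 0 <= Im z -> nsq r.[z] <= c * nsq (z + w) ^+ n.
Proof.
move=> w0; pose K := 2 + (2 * nsq w + 1) / Im w ^+ 2.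
have w2 : 0 < Im w ^+ 2 by rewrite exprn_gt0.
have hw z : 0 <= Im z -> Im w ^+ 2 <= nsq (z + w).
  by move=> z0; rewrite /nsq ImD; have := sqr_ge0 (Re (z + w)); nra.
have K0 : 0 <= K by rewrite addr_ge0 // divr_ge0 ?addr_ge0 ?mulr_ge0 ?nsq_ge0 // ltW.
have hK z : 0 <= Im z -> nsq z <= K * nsq (z + w) /\ 1 <= K * nsq (z + w).
  move=> z0; have h := hw z z0; have hn := nsq_ge0 w.
  have e : 2 * nsq w + 1 <= (2 * nsq w + 1) / Im w ^+ 2 * nsq (z + w).
    by rewrite mulrAC ler_pdivlMr // ler_wpM2l // addr_ge0 // mulr_ge0.
  have : nsq z <= 2 * nsq (z + w) + 2 * nsq w.
    rewrite /nsq !ReD !ImD; have := sqr_ge0 (Re z + 2 * Re w); have := sqr_ge0 (Im z + 2 * Im w); nra.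
  by rewrite /K mulrDl; have := nsq_ge0 (z + w); split; lra.
elim: n r => [|n IH] r.
  move=> /size1_polyC ->; exists (nsq r`_0); first exact: nsq_ge0.
  by move=> z _; rewrite hornerC expr0 mulr1.
elim/poly_ind: r => [|r c _] sr.
  by exists 0 => // z z0; rewrite horner0 nsq_real expr0n mul0r.
have /IH[d d0 hd] : (size r <= n.+1)%N.
  have [->|r0] := eqVneq r 0; first by rewrite size_poly0.
  by move: sr; rewrite size_MXaddC (negPf r0).
exists (2 * K * d + 2 * nsq c * K ^+ n.+1).
  by rewrite addr_ge0 ?mulr_ge0 ?nsq_ge0 ?exprn_ge0.
move=> z z0; have [h1 h2] := hK z z0; have hz := hd z z0.
rewrite hornerD hornerM hornerX hornerC.
have hh (u v : R[i]) : nsq (u + v) <= 2 * nsq u + 2 * nsq v.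
  rewrite /nsq !ReD !ImD; have := sqr_ge0 (Re u - Re v); have := sqr_ge0 (Im u - Im v); nra.
apply: le_trans (hh _ _) _; rewrite nsqM [leRHS]mulrDl lerD //.
  rewrite -!mulrA ler_wpM2l // exprS [d * _]mulrCA !mulrA -[K * _ * _ * _]mulrA mulrC.
  by rewrite ler_pM ?nsq_ge0.
rewrite -!mulrA ler_wpM2l // -exprMn -[leLHS]mulr1 ler_wpM2l ?nsq_ge0 //.
exact: exprn_ege1.
Qed.

Lemma T_Rep (h : {poly R[i]}) : toC (T (Rep h)) = 2^-1 *: (TC h + TC (conjp h)).
Proof. by rewrite toC_T toC_Rep lopZ lopD. Qed.

(** If the image vanished, then for small [e] the polynomial [h + e r] would still have no zero in
    the closed upper half plane, while its real part is sent to [e T r]; so [T r] would be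
    real-rooted for every [r], against [lop_nondegenerate]. *)
Lemma T_pencil_neq0 (c w : R[i]) : c != 0 -> 0 < Im w ->
  rr (Rep (c *: ('X + w%:P) ^+ N)) /\ T (Rep (c *: ('X + w%:P) ^+ N)) != 0.
Proof.
move=> c0 w0; set h := c *: _.
have hz z : 0 <= Im z -> z + w != 0.
  by move=> z0; apply: Im_neq0; rewrite ImD gt_eqF // ltr_wpDl.
have hE z : h.[z] = c * (z + w) ^+ N.
  by rewrite hornerZ horner_exp hornerD hornerX hornerC.
split; first by apply: rr_Rep => z /hz zw; rewrite hE mulf_neq0 ?expf_neq0.
apply/eqP => T0; apply: lop_nondegenerate => r sr.
have sr' : (size (toC r) <= N.+1)%N by rewrite size_map_poly.
have [d d0 hd] := poly_domination w0 sr'.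
(* Chosen with [e^2 d < |c|^2], so that [c (z + w)^N] dominates [e r]. *)
pose e := Num.sqrt (nsq c / (d + 1)).
have c1 : 0 < nsq c by rewrite nsq_gt0.
have d1 : 0 < d + 1 by lra.
have e2 : e ^+ 2 = nsq c / (d + 1) by rewrite sqr_sqrtr // divr_ge0 ?ltW.
have e0 : e != 0 by rewrite sqrtr_eq0 -ltNge divr_gt0.
have RepE : Rep (h + e%:C *: toC r) = Rep h + e *: r.
  by apply/polyP => i; rewrite coefD !coef_Rep coefD ReD (coefZ e%:C) (coefZ e) coef_map Re_real.
have hrr : rr (Rep (h + e%:C *: toC r)).
  apply: rr_Rep => z z0; rewrite hornerD hE hornerZ addr_eq0; apply/eqP => eq.
  have zw : 0 < nsq (z + w) ^+ N by rewrite exprn_gt0 // nsq_gt0 hz.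
  have : nsq (c * (z + w) ^+ N) = e ^+ 2 * nsq (toC r).[z].
    by rewrite eq nsqN nsqM nsq_real.
  rewrite nsqM e2 nsqX.
  move=> eq2; have := hd z z0; rewrite leNgt => /negP; apply.
  rewrite -(ltr_pM2l (_ : 0 < nsq c / (d + 1))) ?divr_gt0 // -eq2.
  rewrite mulrA ltr_pM2r // mulrAC ltr_pdivrMr // ltr_pM2l //; lra.
have -> : T r = e^-1 *: T (Rep (h + e%:C *: toC r)).
  by rewrite RepE lopD T0 add0r lopZ scalerA mulVf // scale1r.
apply/rrZ/T_rr => //; rewrite RepE (leq_trans (size_polyD _ _)) // geq_max.
rewrite (leq_trans (size_scale_leq _ _)) // andbT (leq_trans (size_poly _ _)) //.
rewrite (leq_trans (size_scale_leq _ _)) // (leq_trans (size_poly_exp_leq _ _)) //.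
by rewrite size_XaddC mul1n.
Qed.

(** This is [E x w] of the header. *)
Definition pencil (x w : R[i]) : R[i] := (TC (('X + w%:P) ^+ N)).[x].

Lemma conjp_TC (f : {poly R[i]}) : conjp (TC f) = TC (conjp f).
Proof.
by rewrite /conjp lop_map; apply: eq_lop => [|i]; apply: conjc_real.
Qed.

Lemma conjp_XaddC_exp (w : R[i]) n : conjp (('X + w%:P) ^+ n) = ('X + (conjc w)%:P) ^+ n.
Proof. by rewrite /conjp rmorphXn rmorphD /= map_polyX map_polyC. Qed.

Lemma pencilJ x w : pencil x (conjc w) = conjc (pencil (conjc x) w).
Proof. by rewrite /pencil -horner_conjp conjp_TC conjp_XaddC_exp. Qed.

(** The pencil as a polynomial in [w] for fixed [x]; the definition of [pencil] exhibits it as a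
    polynomial in [x]. *)
Definition pencil_poly (x : R[i]) : {poly R[i]} :=
  \sum_(i < N.+1) ('C(N, i)%:R * (toC (T 'X^i)).[x]) *: 'X^(N - i).

Lemma pencil_polyE x w : (pencil_poly x).[w] = pencil x w.
Proof.
rewrite /pencil addrC exprDn lop_sum !horner_sum; apply: eq_bigr => i _.
rewrite hornerZ hornerXn -rmorphXn mul_polyC -(scaler_nat _ (_ *: _)) scalerA !lopZ hornerZ.
by rewrite toC_T map_polyXn; ring.
Qed.

(* If the moduli agreed, then for some c, T would send the real-rooted c (X + w)^N + conjugate to a
   polynomial vanishing at the nonreal point x. *)
Lemma pencil_separated x w : 0 < Im x -> 0 < Im w ->
  nsq (pencil x (conjc w)) != nsq (pencil x w).
Proof.
move=> x0 w0; apply/eqP => e; set v := pencil x _ in e; set u := pencil x w in e.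
(* For [u != v] the choice [conjc u * (u - v)] works because [|u| = |v|]; for [u = v] it degenerates
   and the imaginary unit is taken. *)
have [c c0 hc] : exists2 c, c != 0 & c * u + conjc c * v = 0.
  have [u0|u0] := eqVneq u 0.
    have v0 : v = 0 by apply/eqP; rewrite -nsq_eq0 e u0 nsq_real expr0n.
    by exists 1; rewrite ?oner_eq0 // u0 v0 !mulr0 addr0.
  have [uv|uv] := eqVneq u v.
    exists 'i%C; first by rewrite -nsq_eq0 /nsq /= expr0n expr1n add0r oner_eq0.
    by rewrite uv -mulrDl; case: v {uv e} => p q; apply/eqP; rewrite eq_complex /=; apply/andP; split; apply/eqP; ring.
  exists (conjc u * (u - v)); first by rewrite mulf_neq0 ?conjc_eq0 ?subr_eq0.
  rewrite rmorphM rmorphB /= conjcK mulrAC [conjc u * u]mulrC mulcJ.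
  have -> : u * (conjc u - conjc v) * v = v * (u * conjc u) - u * (v * conjc v) by ring.
  by rewrite !mulcJ e; ring.
have [hrr /eqP] := T_pencil_neq0 c0 w0; apply.
apply: (rr_vanish (T_rr _ hrr) x0).
  rewrite (leq_trans (size_poly _ _)) // (leq_trans (size_scale_leq _ _)) //.
  by rewrite (leq_trans (size_poly_exp_leq _ _)) // size_XaddC mul1n.
rewrite T_Rep /conjp map_polyZ -/(conjp _) conjp_XaddC_exp !lopZ hornerZ hornerD !hornerZ.
by rewrite -/(pencil x w) -/(pencil x (conjc w)) hc mulr0.
Qed.

(** The moduli never agree by [pencil_separated], and any [(x, w)] is joined to [(i, i)] by two
    segments, one in [x] and one in [w], on which the intermediate value theorem forbids a sign
    change. *)
Lemma pencil_sign :
  (forall x w, 0 < Im x -> 0 < Im w -> nsq (pencil x (conjc w)) < nsq (pencil x w)) \/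
  (forall x w, 0 < Im x -> 0 < Im w -> nsq (pencil x w) < nsq (pencil x (conjc w))).
Proof.
pose Psi x w := nsq (pencil x w) - nsq (pencil x (conjc w)).
have Psi0 x w : 0 < Im x -> 0 < Im w -> Psi x w != 0.
  by move=> x0 w0; rewrite subr_eq0 eq_sym pencil_separated.
have Im_conv (u v : R[i]) t : 0 < Im u -> 0 < Im v -> 0 <= t <= 1 -> 0 < Im (u + t%:C * (v - u)).
  move=> u0 v0 /andP[t0 t1]; rewrite ImD Im_real ImD ImN; nra.
have i0 : 0 < Im ('i%C : R[i]) by rewrite /= ltr01.
have same x w : 0 < Im x -> 0 < Im w -> 0 < Psi 'i%C 'i%C * Psi x w.
  move=> x0 w0; have h1 : 0 < Psi 'i%C 'i%C * Psi x 'i%C.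
    have [g1 hg1] := nsq_poly (TC (('X + ('i%C)%:P) ^+ N)) 'i%C (x - 'i%C).
    have [g2 hg2] := nsq_poly (TC (('X + (conjc 'i%C)%:P) ^+ N)) 'i%C (x - 'i%C).
    have hg t : (g1 - g2).[t] = Psi ('i%C + t%:C * (x - 'i%C)) 'i%C.
      by rewrite hornerD hornerN hg1 hg2.
    have : 0 < (g1 - g2).[0] * (g1 - g2).[1].
      by apply: poly_same_sign => t t01; rewrite hg Psi0 // Im_conv.
    by rewrite !hg mul0r mul1r addr0 addrC subrK.
  have h2 : 0 < Psi x 'i%C * Psi x w.
    have [g1 hg1] := nsq_poly (pencil_poly x) 'i%C (w - 'i%C).
    have [g2 hg2] := nsq_poly (pencil_poly x) (conjc 'i%C) (conjc (w - 'i%C)).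
    have hg t : (g1 - g2).[t] = Psi x ('i%C + t%:C * (w - 'i%C)).
      rewrite hornerD hornerN hg1 hg2 !pencil_polyE /Psi; congr (_ - nsq (pencil _ _)).
      by case: (w - _) => p r; apply/eqP; rewrite eq_complex /=; apply/andP; split; apply/eqP; ring.
    have : 0 < (g1 - g2).[0] * (g1 - g2).[1].
      by apply: poly_same_sign => t t01; rewrite hg Psi0 // Im_conv.
    by rewrite !hg mul0r mul1r addr0 addrC subrK.
  by have := mulr_gt0 h1 h2; have := sqr_ge0 (Psi x 'i%C); nra.
have := Psi0 _ _ i0 i0; case: ltgtP => // h _; [right|left] => x w x0 w0.
  by rewrite -subr_lt0 -/(Psi x w); have := same x w x0 w0; nra.
by rewrite -subr_gt0 -/(Psi x w); have := same x w x0 w0; nra.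
Qed.

Lemma TC_XaddC_exp w :
  TC (('X + w%:P) ^+ N) = \sum_(i < N.+1) ('C(N, i)%:R * w ^+ (N - i)) *: toC (T 'X^i).
Proof.
rewrite addrC exprDn lop_sum; apply: eq_bigr => i _.
by rewrite -rmorphXn mul_polyC -(scaler_nat _ (_ *: _)) scalerA lopZ toC_T map_polyXn.
Qed.

End FixedDegree.

(** * Values and first derivatives at 0 of images under [T] *)

Section BoundaryValues.
Variables (R : rcfType) (a : R) (b lam : nat -> R) (N k l m : nat).
Local Notation toC := (map_poly (real_complex R)).
Local Notation T := (lop a b N.+1).
Local Notation TC := (lop a%:C (real_complex R \o b) N.+1).
Hypothesis a0 : 0 < a.
Local Notation q := (fun i => (-1) ^+ i * b i).

Lemma coef0_lop (f : {poly R}) : (T f)`_0 = \sum_(i < N.+1) q i * (f`_i *+ i`!).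
Proof.
rewrite coef_sum; apply: eq_bigr => i _; rewrite coef_sum big_ord_recl big1 ?addr0.
  rewrite coefZ expr0 mul1r expr0 mul1r dactXn coef_derivn addn0 ffactnn.
  by rewrite /lop_coef bin0 poch0 divr1 mulr1.
by move=> j _; rewrite coefZ lift0 exprS !coef0M coefN coefX oppr0 !mul0r mulr0.
Qed.

(** Modulo [x^2] only the summands [j = 0] and [j = 1] of [T] contribute. *)
Lemma coef1_lop (f : {poly R}) : a * (T f)`_1 =
  \sum_(i < N.+1) q i * (a * (f`_i.+1 *+ i.+1`!) - i%:R * (f`_i *+ i`! - f`_i.+1 *+ i.+1`!)).
Proof.
rewrite coef_sum mulr_sumr; apply: eq_bigr => i _.
(* Extending the range by one makes the term [j = 1] available also for [i = 0]; the added binomial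
   coefficient is 0. *)
have -> : \sum_(j < i.+1) ((-1) ^+ i * b i * lop_coef a i j) *:
    ((- 'X) ^+ j * dact ((1 - 'X) ^+ j * 'X^i) f) =
  \sum_(j < i.+2) ((-1) ^+ i * b i * lop_coef a i j) *:
    ((- 'X) ^+ j * dact ((1 - 'X) ^+ j * 'X^i) f).
  by rewrite [RHS]big_ord_recr /= /lop_coef bin_small // mul0r mulr0 scale0r addr0.
rewrite !big_ord_recl !coefD coef_sum big1 ?addr0; last first.
  move=> j _; rewrite coefZ !lift0 !exprS mulrA mulrNN -(mulrA _ _ (dact _ _)) -(mulrA 'X 'X).
  by rewrite coefXM /= coef0M coefX mul0r mulr0.
rewrite !coefZ !lift0 /= expr0 mul1r expr0 mul1r dactXn coef_derivn addn1.
rewrite !expr1 mulNr coefN coefXM /= dactM dactXn dactDl dact1.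
rewrite dactN dactX coefB -derivnS !coef_derivn !addn0 ffactnn.
rewrite /lop_coef bin0 bin1 poch0 pochS poch0 mul1r addr0 divr1.
have -> : i.+1 ^_ i = i.+1`!.
  by rewrite -[RHS](ffactnn i.+1) ffactnSr subSn // subnn muln1.
have an0 : a != 0 by rewrite gt_eqF.
by rewrite ffactnn; field.
Qed.

(* (D T 'X^i)(0) = i! * bseq i / a, as (T 'X^i)(0) = i! * q i. *)
Definition bseq i := if i is j.+1 then (a + j%:R) * q j - i%:R * q i else 0.

Lemma coef0_lop_Xn i : (i <= N)%N -> (T 'X^i)`_0 = i`!%:R * q i.
Proof.
move=> iN; rewrite coef0_lop (bigD1 (Ordinal (iN : (i < N.+1)%N))) //= big1 ?addr0.
  by rewrite coefXn eqxx mulrC.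
move=> j; rewrite coefXn -val_eqE /= => /negPf ->.
by rewrite mul0rn mulr0.
Qed.

Lemma coef1_lop_Xn i : (i <= N)%N -> a * (T 'X^i)`_1 = i`!%:R * bseq i.
Proof.
move=> iN; rewrite coef1_lop.
pose F j := q j * (a * (('X^i : {poly R})`_j.+1 *+ j.+1`!) + j%:R * (('X^i : {poly R})`_j.+1 *+ j.+1`!)).
pose G j := q j * (j%:R * (('X^i : {poly R})`_j *+ j`!)).
have -> : \sum_(j < N.+1) q j * (a * (('X^i : {poly R})`_j.+1 *+ j.+1`!) -
   j%:R * (('X^i : {poly R})`_j *+ j`! - ('X^i : {poly R})`_j.+1 *+ j.+1`!)) =
   \sum_(j < N.+1) F j - \sum_(j < N.+1) G j.
  by rewrite -sumrB; apply: eq_bigr => j _; rewrite /F /G; ring.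
have -> : \sum_(j < N.+1) G j = q i * (i%:R * i`!%:R).
  rewrite (bigD1 (Ordinal (iN : (i < N.+1)%N))) //= big1 ?addr0.
    by rewrite /G coefXn eqxx.
  by move=> j; rewrite /G coefXn -val_eqE /= => /negPf ->; rewrite mul0rn !mulr0.
rewrite {}/F {G}; case: i iN => [|i] iN.
  rewrite big1 ?mul0r ?mulr0 ?subr0 // => j _.
  by rewrite coefXn /= mul0rn !mulr0 addr0 mulr0.
have iN1 : (i < N.+1)%N by apply: ltnW.
rewrite (bigD1 (Ordinal iN1)) //= big1 ?addr0.
  by rewrite coefXn eqxx /=; ring.
by move=> j; rewrite coefXn -val_eqE /= eqSS => /negPf ->; rewrite mul0rn !mulr0 addr0 mulr0.
Qed.

End BoundaryValues.

(** * First-order information from a modulus inequality on the imaginary axis *)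

Section BoundaryDerivative.
Variable R : rcfType.
Local Notation toC := (map_poly (real_complex R)).

Lemma coef1_deriv (K : nzRingType) (f : {poly K}) : f`_1 = f^`().[0].
Proof. by rewrite horner_coef0 coef_deriv mulr1n. Qed.

(** The difference [|p(it)|^2 - |p(-it)|^2] vanishes at [t = 0] and is nonnegative for [t > 0], so
    its derivative at 0, which is [- 4 Im (p_1 * conj p_0)], is nonnegative. *)
Lemma boundary_derivative (p : {poly R[i]}) :
    (forall e : R, 0 < e -> nsq p.[- (e%:C * 'i%C)] <= nsq p.[e%:C * 'i%C]) ->
  Im (p`_1 * conjc p`_0) <= 0.
Proof.
move=> hp; pose P := p \Po ('i%C *: 'X); pose g := Rep (P * conjp P).
have hg t : g.[t] = nsq p.[t%:C * 'i%C].
  rewrite horner_Rep hornerM horner_conjp conjc_real mulcJ /=.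
  by rewrite horner_comp hornerZ hornerX mulrC.
pose h := g - (g \Po - 'X).
have hh e : h.[e] = nsq p.[e%:C * 'i%C] - nsq p.[- (e%:C * 'i%C)].
  by rewrite hornerD hornerN horner_comp hornerN hornerX !hg rmorphN mulNr.
have [h2 hE] : exists h2, h = h2 * ('X - 0%:P).
  by apply/factor_theorem; rewrite /root hh rmorph0 mul0r oppr0 subrr.
have h2_ge0 : 0 <= h2.[0].
  apply: poly_ge0_limit => d d0; exists (d / 2); split; [lra|lra|].
  have d20 : 0 < d / 2 by lra.
  have := hp _ d20; rewrite -subr_ge0 -hh hE hornerM hornerXsubC subr0.
  by rewrite pmulr_lge0.
have e1 : h2.[0] = 2 * g`_1.
  have : h^`().[0] = h2.[0].
    by rewrite hE derivM hornerD !hornerM hornerXsubC subrr mulr0 add0r derivXsubC hornerC mulr1.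
  move=> <-; rewrite /h derivB deriv_comp derivN derivX hornerD hornerN hornerM horner_comp.
  rewrite !hornerN hornerX hornerC oppr0 coef1_deriv; ring.
have e2 : g`_1 = - (2 * Im (p`_1 * conjc p`_0)).
  have P0 : P`_0 = p`_0 by rewrite -!horner_coef0 horner_comp hornerZ hornerX mulr0.
  have P1 : P`_1 = p`_1 * 'i%C.
    rewrite !coef1_deriv deriv_comp derivZ derivX hornerM horner_comp !hornerZ hornerX.
    by rewrite hornerC mulr0 mulr1.
  rewrite coef_Rep coefM !big_ord_recl big_ord0 /= !coef_map P0 P1 /=.
  by case: (p`_0) => u v; case: (p`_1) => x y /=; ring.
by move: h2_ge0; rewrite e1 e2; lra.
Qed.

End BoundaryDerivative.

(** * Reversed polynomials with falling factorial coefficients *)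

Section FactorialPolynomials.
Variable R : rcfType.
Local Notation toC := (map_poly (real_complex R)).

Definition rpoly n (u : nat -> R) : {poly R} := \poly_(j < n.+1) u (n - j)%N.

(** For [u i = (-1)^i b_i] this is [A] of the header, and for [u = bseq a b] it is [V]. *)
Definition ffpoly (u : nat -> R) n : {poly R} := rpoly n (fun i => (n ^_ i)%:R * u i).

Lemma coef_rpoly n (u : nat -> R) j : (rpoly n u)`_j = if (j <= n)%N then u (n - j)%N else 0.
Proof. by rewrite coef_poly ltnS. Qed.

Lemma coef_ffpoly (u : nat -> R) n j :
  (ffpoly u n)`_j = if (j <= n)%N then (n ^_ (n - j))%:R * u (n - j)%N else 0.
Proof. by rewrite coef_rpoly. Qed.

Lemma ffpolyE u n : ffpoly u n = \sum_(i < n.+1) ((n ^_ i)%:R * u i) *: 'X^(n - i).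
Proof.
rewrite /ffpoly /rpoly poly_def (reindex_inj rev_ord_inj); apply: eq_bigr => i _.
by rewrite /= subSS subKn // -ltnS.
Qed.

Lemma horner_ffpoly u n (z : R[i]) :
  (toC (ffpoly u n)).[z] = \sum_(i < n.+1) ((n ^_ i)%:R * u i)%:C * z ^+ (n - i).
Proof.
rewrite ffpolyE rmorph_sum horner_sum; apply: eq_bigr => i _.
by rewrite /= map_polyZ map_polyXn hornerZ hornerXn.
Qed.

End FactorialPolynomials.

(** * Sign condition and stability at the boundary point [x = 0] *)

Section Boundary.
Variables (R : rcfType) (a : R) (b lam : nat -> R) (N k l m : nat).
Local Notation toC := (map_poly (real_complex R)).
Local Notation T := (lop a b N.+1).
Local Notation TC := (lop a%:C (real_complex R \o b) N.+1).
Hypothesis a0 : 0 < a.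
Hypothesis T_rr : forall f : {poly R}, (size f <= N.+1)%N -> rr f -> rr (T f).
Hypothesis T_lag : forall n, (n <= N)%N -> T (lag (a - 1) n) = lam n *: lag (a - 1) n.
Hypothesis kl : (k.+1 < l)%N.
Hypothesis lN : (l <= N)%N.
Hypothesis lamk : lam k != 0.
Hypothesis laml : lam l != 0.
Hypothesis mN : (m <= N)%N.
Hypothesis bm : b m != 0.
Hypothesis bm0 : forall i, (i < m)%N -> b i = 0.

Let A := ffpoly (fun i => (-1) ^+ i * b i) N.
Let V := ffpoly (bseq a b) N.

Lemma pencil_at0 w : pencil a b N 0 w = (toC A).[w].
Proof.
rewrite -pencil_polyE /pencil_poly horner_sum horner_ffpoly; apply: eq_bigr => i _.
rewrite hornerZ hornerXn horner_coef0 coef_map coef0_lop_Xn ?leq_ord //.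
rewrite -bin_ffact natrM !rmorphM !rmorph_nat; ring.
Qed.

Lemma coef0_TC w : (TC (('X + w%:P) ^+ N))`_0 = (toC A).[w].
Proof. by rewrite -horner_coef0 -pencil_at0. Qed.

Lemma coef1_TC w : a%:C * (TC (('X + w%:P) ^+ N))`_1 = (toC V).[w].
Proof.
rewrite TC_XaddC_exp coef_sum mulr_sumr horner_ffpoly; apply: eq_bigr => i _.
rewrite coefZ coef_map /= mulrCA -rmorphM coef1_lop_Xn ?leq_ord //.
rewrite -bin_ffact natrM !rmorphM !rmorph_nat; ring.
Qed.

(** [boundary_derivative] is applied in the variable [x], since [pencilJ] turns conjugation of [w]
    into conjugation of [x]; in the second case it is applied to the conjugate polynomial. *)
Lemma boundary_sign :
  (forall w, 0 < Im w -> Im ((toC V).[w] * conjc (toC A).[w]) <= 0) \/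
  (forall w, 0 < Im w -> 0 <= Im ((toC V).[w] * conjc (toC A).[w])).
Proof.
have aE (u v : R[i]) : Im (a%:C * u * v) = a * Im (u * v) by rewrite -mulrA Im_real.
have i0 (e : R) : 0 < e -> 0 < Im (e%:C * 'i%C) by rewrite Im_real /= mulr1.
have iJ (e : R) : - (e%:C * 'i%C) = conjc (e%:C * 'i%C).
  by apply/eqP; rewrite eq_complex /=; apply/andP; split; apply/eqP; ring.
case: (pencil_sign a0 T_rr T_lag kl lN lamk laml) => h; [left|right] => w w0.
  rewrite -coef1_TC -coef0_TC aE pmulr_rle0 //; apply: boundary_derivative => e e0.
  rewrite iJ -/(pencil a b N _ w) -/(pencil a b N _ w).
  have := h _ w (i0 e e0) w0; rewrite pencilJ nsqJ; exact: ltW.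
rewrite -coef1_TC -coef0_TC aE pmulr_rge0 //.
rewrite -oppr_le0 -ImJ rmorphM /= conjcK.
have := @boundary_derivative R (conjp (TC (('X + w%:P) ^+ N))).
rewrite !coef_map /= conjcK; apply => e e0.
rewrite !horner_conjp iJ conjcK !nsqJ -iJ iJ.
rewrite -/(pencil a b N _ w) -/(pencil a b N _ w).
have := h _ w (i0 e e0) w0; rewrite pencilJ nsqJ; exact: ltW.
Qed.

(** For [x] in the upper half plane, [pencil_sign] makes the pencil in [w], or its conjugate,
    stable. Its coefficient of degree [N - m] stays nonzero at [x = 0], so the lower bound of
    [stable_coef_bound] persists as [x = i e] tends to 0. *)
Lemma boundary_stable : stable (toC A).
Proof.
pose tau := toC (T 'X^m).
have tau_lt i : (i < m)%N -> T 'X^i = 0.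
  move=> im; rewrite /lop big1 // => j _; rewrite big1 // => j' _.
  have [jm|jm] := ltnP j m; first by rewrite bm0 // mulr0 mul0r scale0r.
  rewrite dactM dactXn derivn_poly0 ?dact0r ?mulr0 ?scaler0 //.
  by rewrite size_polyXn (leq_trans im).
have size_pp x : (size (pencil_poly a b N x) <= (N - m).+1)%N.
  apply/leq_sizeP => j hj; rewrite coef_sum big1 // => i _.
  rewrite coefZ coefXn; case: eqP => [ji|]; last by rewrite mulr0.
  rewrite tau_lt ?rmorph0 ?horner0 ?mulr0 ?mul0r //.
  by move: hj (ltn_ord i) mN; rewrite ji; lia.
have coef_pp x : (pencil_poly a b N x)`_(N - m) = 'C(N, m)%:R * tau.[x].
  rewrite coef_sum (bigD1 (Ordinal (mN : (m < N.+1)%N))) //= big1 ?addr0.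
    by rewrite coefZ coefXn eqxx mulr1.
  move=> i; rewrite -val_eqE /= => im; rewrite coefZ coefXn; case: eqP => [|_]; last by rewrite mulr0.
  by move: im (ltn_ord i) mN => /eqP; lia.
move=> w w0.
have key (z : R[i]) (P := fun x => nsq (pencil a b N x z)) :
    (forall x, 0 < Im x -> nsq ('C(N, m)%:R * tau.[x]) * Im w ^+ 2 ^+ (N - m) <= P x) ->
  nsq ('C(N, m)%:R * tau.[0]) * Im w ^+ 2 ^+ (N - m) <= P 0.
  move=> h; have [g1 hg1] := nsq_poly ('C(N, m)%:R *: tau) 0 'i%C.
  have [g2 hg2] := nsq_poly (TC (('X + z%:P) ^+ N)) 0 'i%C.
  have : 0 <= (g2 - (Im w ^+ 2 ^+ (N - m)) *: g1).[0].
    apply: poly_ge0_limit => d d0; exists (d / 2); split; [lra|lra|].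
    rewrite hornerD hornerN hornerZ hg1 hg2 subr_ge0 add0r mulrC hornerZ; apply: h.
    by rewrite Im_real /= mulr1; lra.
  by rewrite hornerD hornerN hornerZ hg1 hg2 subr_ge0 add0r mul0r mulrC hornerZ.
have tau0 : 0 < nsq ('C(N, m)%:R * tau.[0]) * Im w ^+ 2 ^+ (N - m).
  rewrite mulr_gt0 ?exprn_gt0 // nsq_gt0 mulf_neq0 ?pnatr_eq0 -?lt0n ?bin_gt0 //.
  rewrite horner_coef0 coef_map fmorph_eq0 coef0_lop_Xn // mulf_neq0 ?factr_neq0 //.
  by rewrite mulf_neq0 ?signr_eq0.
have bound (p : {poly R[i]}) x : stable p -> (size p <= (N - m).+1)%N ->
    nsq p`_(N - m) = nsq ('C(N, m)%:R * tau.[x]) ->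
    nsq ('C(N, m)%:R * tau.[x]) * Im w ^+ 2 ^+ (N - m) <= nsq p.[w].
  by move=> sp szp <-; apply: stable_coef_bound.
rewrite -pencil_at0 -nsq_gt0.
case: (pencil_sign a0 T_rr T_lag kl lN lamk laml) => h.
  apply: lt_le_trans tau0 (key w _) => x x0; rewrite -pencil_polyE.
  apply: bound; rewrite ?size_pp ?coef_pp //.
  move=> z z0; rewrite pencil_polyE -nsq_gt0.
  by apply: le_lt_trans (h x z x0 z0); apply: nsq_ge0.
rewrite -[w]conjcK pencilJ conjc0 nsqJ.
apply: lt_le_trans tau0 (key (conjc w) _) => x x0; rewrite -pencil_polyE.
rewrite -[leRHS]nsqJ -horner_conjp; apply: bound.
- move=> z z0; rewrite horner_conjp conjc_eq0 pencil_polyE -nsq_gt0.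
  by apply: le_lt_trans (h x z x0 z0); apply: nsq_ge0.
- by rewrite (leq_trans (size_poly _ _)).
by rewrite coef_map nsqJ coef_pp.
Qed.

End Boundary.

(** * Growth of a quotient [r / q] mapping the upper half plane to the closed lower one *)

Section PickBound.
Variable R : rcfType.
Local Notation toC := (map_poly (real_complex R)).
Variables (q r : {poly R}) (n : nat).
Hypothesis size_q : size q = n.+2.
Hypothesis size_r : (size r <= n.+1)%N.
Hypothesis stable_q : stable (toC q).
Hypothesis pick : forall w, 0 < Im w -> Im ((toC r).[w] * conjc (toC q).[w]) <= 0.

(** A root in the lower half plane would give [q = al r] there and contradict [pick] at the
    conjugate point. The sum of the imaginary parts is read off from the coefficient of degree
    [n]. *)
Lemma pick_shift_roots (al : R[i]) : 0 < Im al -> exists zs : seq R[i],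
  [/\ toC q - al *: toC r = (q`_n.+1)%:C *: \prod_(z <- zs) ('X - z%:P), size zs = n.+1,
      {in zs, forall z, 0 <= Im z} & q`_n.+1 * \sum_(z <- zs) Im z = Im al * r`_n].
Proof.
move=> al0; set p := toC q - _.
have qn : q`_n.+1 != 0.
  have -> : q`_n.+1 = lead_coef q by rewrite lead_coefE size_q.
  by rewrite lead_coef_eq0 -size_poly_eq0 size_q.
have sp : size p = n.+2.
  rewrite size_polyDl size_map_poly // size_polyN size_q ltnS.
  by rewrite (leq_trans (size_scale_leq _ _)) // size_map_poly.
have lp : lead_coef p = (q`_n.+1)%:C.
  rewrite lead_coefE sp coefB coefZ !coef_map /= (nth_default 0 size_r).
  by rewrite rmorph0 mulr0 subr0.
have [zs pE] := poly_factor p; rewrite lp in pE.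
have szs : size zs = n.+1.
  have := congr1 (fun f : {poly R[i]} => size f) pE; rewrite size_scale ?fmorph_eq0 //.
  by rewrite size_prod_XsubC sp => -[].
exists zs; split => //.
  move=> z zzs; rewrite leNgt; apply/negP => z0.
  have : p.[z] = 0.
    by rewrite pE hornerZ horner_prod_XsubC (big_rem z zzs) /= subrr mul0r mulr0.
  rewrite hornerD hornerN hornerZ => /eqP; rewrite subr_eq0 => /eqP e.
  have z0' : 0 < Im (conjc z) by rewrite ImJ oppr_gt0.
  have := pick z0'; have := stable_q z0'; rewrite !horner_toCJ e conjcK conjc_eq0.
  rewrite mulf_eq0 negb_or => /andP[_ rz].
  rewrite mulrCA [conjc _ * _]mulrC mulcJ mulrC Im_real leNgt => /negP; apply.
  by rewrite mulr_gt0 // nsq_gt0.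
have := congr1 (fun f : {poly R[i]} => Im f`_n) pE.
rewrite coefZ -[n in RHS]/(n.+1.-1) -szs coefPn_prod_XsubC ?szs // Im_real ImN Im_sum.
rewrite coefB coefZ !coef_map ImD ImN [al * _]mulrC Im_real /= => e.
by rewrite -[LHS]opprK -mulrN -e; ring.
Qed.

(** With [al = q(w) / r(w)], [w] is one of the roots of [pick_shift_roots], so [Im w] is at most the
    sum [Im al * r_n / q_(n+1)], and [|Im al| <= |al|]. *)
Lemma pick_bound w : 0 < Im w ->
  (q`_n.+1 * Im w) ^+ 2 * nsq (toC r).[w] <= r`_n ^+ 2 * nsq (toC q).[w].
Proof.
move=> w0; have [r0|r0] := eqVneq (toC r).[w] 0.
  by rewrite r0 nsq_real expr0n mulr0 mulr_ge0 ?sqr_ge0 ?nsq_ge0.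
pose al := (toC q).[w] / (toC r).[w].
have rn : 0 < nsq (toC r).[w] by rewrite nsq_gt0.
have al_ge0 : 0 <= Im al.
  rewrite Im_div divr_ge0 ?nsq_ge0 // -oppr_le0 -ImJ rmorphM /= conjcK mulrC.
  exact: pick.
have qal : (toC q).[w] = al * (toC r).[w] by rewrite /al divfK.
have [al0|al0] := ltP 0 (Im al).
  have [zs [pE szs zs0 sumE]] := pick_shift_roots al0.
  have : (toC q - al *: toC r).[w] = 0 by rewrite hornerD hornerN hornerZ qal subrr.
  have qn : q`_n.+1 != 0.
    have -> : q`_n.+1 = lead_coef q by rewrite lead_coefE size_q.
    by rewrite lead_coef_eq0 -size_poly_eq0 size_q.
  rewrite pE hornerZ horner_prod_XsubC => /eqP; rewrite mulf_eq0 fmorph_eq0 (negPf qn) /=.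
  rewrite prodf_seq_eq0 => /hasP[z zzs] /=; rewrite subr_eq0 => /eqP zw.
  have : Im w <= \sum_(z <- zs) Im z.
    rewrite (big_rem z zzs) /= zw lerDl big_seq sumr_ge0 // => y /mem_rem; exact: zs0.
  move: sumE; set S := \sum_(z <- zs) _ => sumE wS.
  rewrite qal nsqM mulrA ler_pM2r // exprMn.
  have h1 : Im w ^+ 2 <= S ^+ 2 by rewrite ler_sqr ?nnegrE ?(ltW w0) // (le_trans (ltW w0)).
  have h2 : q`_n.+1 ^+ 2 * Im w ^+ 2 <= (Im al * r`_n) ^+ 2.
    by rewrite -sumE exprMn ler_wpM2l ?sqr_ge0.
  apply: le_trans h2 _; rewrite exprMn mulrC ler_wpM2l ?sqr_ge0 //.
  by rewrite /nsq lerDr sqr_ge0.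
have {al_ge0 al0}al0 : Im al = 0 by apply/le_anti; rewrite al0 al_ge0.
(* A real [al] is impossible: for [al + i e] with small [e] all roots stay at distance at least
   [Im w / 2] from [w], while the value at [w] has modulus [e |r(w)|], which tends to 0. *)
exfalso.
have qn : q`_n.+1 != 0.
  have -> : q`_n.+1 = lead_coef q by rewrite lead_coefE size_q.
  by rewrite lead_coef_eq0 -size_poly_eq0 size_q.
pose c := `|r`_n / q`_n.+1|.
have c0 : 0 <= c by rewrite normr_ge0.
(* perturb al upwards by e: all the roots have imaginary part at most c e *)
pose K := q`_n.+1 ^+ 2 * (Im w / 2) ^+ 2 ^+ n.+1.
have K0 : 0 < K.
  apply: mulr_gt0; first by rewrite lt0r sqrf_eq0 qn sqr_ge0.
  by rewrite !exprn_gt0 // divr_gt0.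
have step e : 0 < e -> c * e <= Im w / 2 -> K <= e ^+ 2 * nsq (toC r).[w].
  move=> e0 ce; have ale : 0 < Im (al + e%:C * 'i%C) by rewrite ImD Im_real al0 /= mulr1 add0r.
  have [zs [pE szs zs0 sumE]] := pick_shift_roots ale.
  have : (toC q - (al + e%:C * 'i%C) *: toC r).[w] = - (e%:C * 'i%C * (toC r).[w]).
    by rewrite hornerD hornerN hornerZ qal; ring.
  move=> /(congr1 (@nsq R)); rewrite nsqN !nsqM nsq_real [nsq 'i%C]/nsq /= expr0n expr1n add0r mulr1.
  move=> <-; rewrite pE hornerZ horner_prod_XsubC nsqM nsq_real ler_wpM2l ?sqr_ge0 //.
  rewrite -szs; have : {in zs, forall z, (Im w / 2) ^+ 2 <= nsq (w - z)}.
    move=> z zzs; have zS : Im z <= \sum_(z <- zs) Im z.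
      rewrite (big_rem z zzs) /= lerDl big_seq sumr_ge0 // => y /mem_rem; exact: zs0.
    have zc : Im z <= c * e.
      apply: le_trans zS _; apply: le_trans (ler_norm _) _.
      have -> : \sum_(z <- zs) Im z = e * (r`_n / q`_n.+1).
        apply: (mulfI qn); rewrite sumE ImD Im_real al0 /= mulr1 add0r; field.
        exact: qn.
      by rewrite normrM gtr0_norm // mulrC.
    rewrite /nsq ImD ImN; have := sqr_ge0 (Re (w - z)).
    have := zs0 _ zzs; have : Im w / 2 <= Im w - Im z by lra.
    have w20 : 0 <= Im w / 2 by lra.
    by move=> h1 h2 h3; nra.
  rewrite nsq_prod; elim: (zs) => [|z zs' IH] hz; first by rewrite expr0 big_nil.
  rewrite /= exprS big_cons ler_pM ?exprn_ge0 ?divr_ge0 ?(ltW w0) //.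
    by rewrite hz ?mem_head.
  by apply: IH => y yzs; rewrite hz // inE yzs orbT.
(* [e = 1 / Z] meets both demands: the middle term gives [c e <= Im w / 2], the last one
   [e^2 |r(w)|^2 < K]. *)
pose Z := 1 + 2 * c / Im w + nsq (toC r).[w] / K.
have cw : 0 <= c / Im w by rewrite divr_ge0 // ltW.
have rK : 0 <= nsq (toC r).[w] / K by rewrite divr_ge0 ?ltW.
have Z1 : 1 <= Z by rewrite /Z -mulrA; lra.
have Z0 : 0 < Z by lra.
have e0 : 0 < Z^-1 by rewrite invr_gt0.
have ce : c * Z^-1 <= Im w / 2.
  rewrite ler_pdivrMr //; have -> : c = Im w / 2 * (2 * c / Im w) by field; rewrite gt_eqF.
  by rewrite ler_wpM2l ?divr_ge0 ?(ltW w0) // /Z; lra.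
have := step _ e0 ce; rewrite leNgt => /negP; apply.
rewrite exprVn mulrC ltr_pdivrMr ?exprn_gt0 //.
have -> : nsq (toC r).[w] = K * (nsq (toC r).[w] / K) by field; rewrite gt_eqF.
rewrite ltr_pM2l //; apply: lt_le_trans (_ : Z <= _); last by rewrite expr2; nra.
by rewrite /Z -mulrA; lra.
Qed.

End PickBound.

(** * The modulus as a real number *)

Section ComplexNorm.
Variable R : rcfType.
Implicit Types (z w : R[i]).

Definition cnorm z : R := Num.sqrt (nsq z).

Lemma cnorm_ge0 z : 0 <= cnorm z.
Proof. exact: sqrtr_ge0. Qed.

Lemma cnormM z w : cnorm (z * w) = cnorm z * cnorm w.
Proof. by rewrite /cnorm nsqM sqrtrM ?nsq_ge0. Qed.

Lemma cnormN z : cnorm (- z) = cnorm z.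
Proof. by rewrite /cnorm nsqN. Qed.

Lemma cnorm_real (x : R) : cnorm x%:C = `|x|.
Proof. by rewrite /cnorm nsq_real sqrtr_sqr. Qed.

Lemma cnormD z w : cnorm (z + w) <= cnorm z + cnorm w.
Proof.
have := @le_normcD R z w; rewrite /cnorm /nsq.
by case: z => a b; case: w => c d.
Qed.

Lemma cnormB z w : cnorm (z - w) <= cnorm z + cnorm w.
Proof. by rewrite -[cnorm w]cnormN cnormD. Qed.

Lemma cnorm_sum (I : Type) (r : seq I) (F : I -> R[i]) :
  cnorm (\sum_(i <- r) F i) <= \sum_(i <- r) cnorm (F i).
Proof.
elim/big_ind2: _ => [|x1 x2 y1 y2 h1 h2|//]; first by rewrite cnorm_real normr0.
by apply: le_trans (cnormD _ _) _; apply: lerD.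
Qed.

Lemma Re_le_cnorm z : Re z <= cnorm z.
Proof.
apply: le_trans (ler_norm _) _; rewrite -sqrtr_sqr ler_wsqrtr //.
by rewrite /nsq lerDl sqr_ge0.
Qed.

Lemma cnorm_le z (x : R) : 0 <= x -> nsq z <= x ^+ 2 -> cnorm z <= x.
Proof. by move=> x0 h; rewrite -[leRHS]ger0_norm // -sqrtr_sqr; apply: ler_wsqrtr. Qed.

End ComplexNorm.

Lemma logderiv2_prod (K : fieldType) (rs : seq K) (z : K) : z \notin rs ->
  let P := \prod_(r <- rs) ('X - r%:P) in
  P^`()^`().[z] =
    P.[z] * ((\sum_(r <- rs) (z - r)^-1) ^+ 2 - \sum_(r <- rs) (z - r)^-1 ^+ 2).
Proof.
elim: rs => [|r rs IH] /=.
  by rewrite !big_nil expr0n subrr -[1]/(1%:P) !derivC horner0 mulr0.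
rewrite inE negb_or => /andP[zr zrs]; have := IH zrs; have := logderiv_prod zrs.
rewrite !big_cons; set P := \prod_(_ <- _) _ => /= h1 h2.
rewrite !derivM !derivXsubC mul1r derivD derivM derivXsubC mul1r.
rewrite !hornerD !hornerM hornerXsubC h2 h1.
have h : z - r != 0 by rewrite subr_eq0.
by field.
Qed.

(** * Bounding the number of nonzero roots *)

Section RootCount.
Variable R : archiRcfType.
Local Notation toC := (map_poly (real_complex R)).
Variables (ws : seq R) (c be c0 : R).
Local Notation D := (size ws).
Let A : {poly R} := c *: \prod_(w <- ws) ('X - w%:P).
Let r : {poly R} := ('X + (D%:R + be)%:P) * A^`() - D%:R *: A - 'X * A^`()^`().
Let B : R := 2 * (`|c0| + `|be| + 1).
Hypothesis c_neq0 : c != 0.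
Hypothesis bound : forall t, 0 < t ->
  t ^+ 2 * nsq (toC r).[t%:C * 'i%C] <= (D%:R * c0) ^+ 2 * nsq (toC A).[t%:C * 'i%C].
Hypothesis D_large : 8 * B <= D%:R.

Let S t := \sum_(w <- ws) w ^+ 2 / (t ^+ 2 + w ^+ 2).

(* S t avoids the interval (B, D / 2]: with z = i t and X = sum_w w / (w - z), S t = Re X, and the bound
   forces |X| |D - X - z| <= D * B / 2. As S t tends to 0 for large t and at most quadruples when t is
   halved, it stays below B down to t = 0, where it counts the nonzero roots. *)
Lemma root_count_gap t : 0 < t -> S t <= D%:R / 2 -> S t <= B.
Proof.
move=> t0 hS; pose z := t%:C * 'i%C; pose cs := [seq w%:C | w <- ws].
have B0 : 0 <= `|c0| + `|be| + 1 by rewrite !addr_ge0.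
have zn : z \notin cs.
  apply/negP => /mapP[w _] /(congr1 (@complex.Im R)) /=.
  by rewrite mulr1 mul0r addr0 => t00; rewrite t00 ltxx in t0.
have AC : toC A = c%:C *: \prod_(w <- cs) ('X - w%:P).
  rewrite map_polyZ rmorph_prod big_map; congr (_ *: _); apply: eq_bigr => w _.
  by rewrite rmorphB /= map_polyX map_polyC.
have Az : (toC A).[z] != 0.
  rewrite AC hornerZ mulf_neq0 ?fmorph_eq0 // horner_prod_XsubC prodf_seq_neq0.
  by apply/allP => w wcs; rewrite subr_eq0; apply: contraNneq zn => ->.
pose S1 := \sum_(w <- cs) (z - w)^-1; pose S2 := \sum_(w <- cs) (z - w)^-1 ^+ 2.
have A1 : (toC A)^`().[z] = (toC A).[z] * S1.
  by rewrite AC derivZ !hornerZ logderiv_prod // mulrA.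
have A2 : (toC A)^`()^`().[z] = (toC A).[z] * (S1 ^+ 2 - S2).
  by rewrite AC !derivZ !hornerZ logderiv2_prod // mulrA.
(* [G] is [z r / A] at [z], written with sums over the roots. *)
pose G := (z + (D%:R + be)%:C) * (z * S1) - z * D%:R%:C - (z * S1) ^+ 2 + z ^+ 2 * S2.
have rE : z * (toC r).[z] = (toC A).[z] * G.
  rewrite /r !rmorphB !rmorphM rmorphD /= map_polyX map_polyC map_polyZ /= -!deriv_map.
  rewrite !hornerD !hornerN !hornerM hornerD hornerX hornerC hornerZ A1 A2 /G.
  ring.
have cG : cnorm G <= D%:R * `|c0|.
  apply: cnorm_le; first by rewrite mulr_ge0.
  have An : 0 < nsq (toC A).[z] by rewrite nsq_gt0.
  rewrite exprMn -normrX ger0_norm ?sqr_ge0 // -exprMn -(ler_pM2l An) -nsqM -rE nsqM.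
  have -> : nsq z = t ^+ 2 by rewrite nsqM nsq_real /nsq /= expr0n expr1n add0r mulr1.
  by rewrite [leRHS]mulrC bound.
pose ST := z * S1; pose X := D%:R%:C - ST.
have STE : ST = \sum_(w <- cs) z / (z - w) by rewrite /ST mulr_sumr.
have ST2E : z ^+ 2 * S2 = \sum_(w <- cs) (z / (z - w)) ^+ 2.
  by rewrite mulr_sumr; apply: eq_bigr => w _; rewrite [RHS]exprMn.
have tw0 (w : R) : 0 < t ^+ 2 + w ^+ 2 by rewrite ltr_wpDr ?sqr_ge0 ?exprn_gt0.
(* As [z] is purely imaginary and [w] real, [|z| <= |z - w|]. *)
have T1 w : w \in cs -> cnorm (z / (z - w)) <= 1.
  move=> /mapP[{}w _ ->]; apply: cnorm_le => //; rewrite expr1n.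
  have zw : 0 < nsq (z - w%:C) by rewrite /nsq /=; have := tw0 w; nra.
  have -> : nsq (z / (z - w%:C)) = nsq z / nsq (z - w%:C).
    apply: (mulIf (lt0r_neq0 zw)); rewrite -nsqM divfK -?nsq_gt0 // divfK ?gt_eqF //.
  rewrite ler_pdivrMr // mul1r /nsq /=; nra.
have szcs : size cs = D by rewrite size_map.
have sum1 (F : R[i] -> R[i]) : {in cs, forall w, cnorm (F w) <= 1} ->
    cnorm (\sum_(w <- cs) F w) <= D%:R.
  move=> hF; apply: le_trans (cnorm_sum _ _) _.
  rewrite -szcs -sum1_size natr_sum big_seq [leRHS]big_seq.
  by apply: ler_sum => w /hF.
have cST : cnorm ST <= D%:R by rewrite STE; apply: sum1.
have cST2 : cnorm (z ^+ 2 * S2) <= D%:R.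
  rewrite ST2E; apply: sum1 => w /T1 h; rewrite expr2 cnormM.
  by have := cnorm_ge0 (z / (z - w)); nra.
(* The terms on the right have moduli at most [|c0| D], [|be| D] and [D]. *)
have XE : X * (ST - z) = G - be%:C * ST - z ^+ 2 * S2.
  by rewrite /X /G -/ST rmorphD; ring.
have cX : cnorm X * cnorm (ST - z) <= D%:R * (`|c0| + `|be| + 1).
  rewrite -cnormM XE; apply: le_trans (cnormB _ _) _.
  rewrite !mulrDr mulr1 lerD //; apply: le_trans (cnormB _ _) _; rewrite lerD //.
  by rewrite cnormM cnorm_real mulrC ler_wpM2r.
have ReX : Re X = S t.
  rewrite /X STE ReD ReN Re_sum /= big_map -sum1_size natr_sum -sumrB.
  apply: eq_bigr => w _; rewrite ReM Re_inv Im_inv /nsq /=.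
  have := tw0 w => h; rewrite !(mul0r, mulr0, mulr1, subr0, addr0, oppr0, add0r, sub0r).
  rewrite sqrrN addrC; field.
  by rewrite gt_eqF.
have D0 : 0 < D%:R :> R by apply: lt_le_trans D_large; rewrite /B; have := normr_ge0 c0; have := normr_ge0 be; lra.
have cSTz : D%:R / 2 <= cnorm (ST - z).
  have Rez : Re z = 0 by rewrite /z Re_real /= mulr0.
  apply: le_trans _ (Re_le_cnorm _); rewrite ReD ReN Rez subr0.
  have -> : Re ST = D%:R - Re X by rewrite /X ReD ReN /=; ring.
  rewrite ReX; lra.
have cX2 : cnorm X <= B.
  have h := cnorm_ge0 X.
  have : cnorm X * (D%:R / 2) <= D%:R * (`|c0| + `|be| + 1).
    by apply: le_trans cX; rewrite ler_wpM2l.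
  have -> : D%:R * (`|c0| + `|be| + 1) = B * (D%:R / 2) by rewrite /B; field.
  by rewrite ler_pM2r // divr_gt0.
by rewrite -ReX; apply: le_trans cX2; apply: Re_le_cnorm.
Qed.

(** Starting at [t = 1 + W], where [S t <= 1], halving keeps [S] below [B]: the next value is at
    most [4 B <= D / 2], so [root_count_gap] applies. On the other hand [S t] is at least the number
    of nonzero roots minus [t^2 Z]. *)
Lemma root_count : (count (fun w => w != 0) ws)%:R <= B.
Proof.
have B1 : 1 <= B by rewrite /B; have := normr_ge0 c0; have := normr_ge0 be; lra.
pose W := \sum_(w <- ws) w ^+ 2.
have W0 : 0 <= W by rewrite sumr_ge0 // => w _; apply: sqr_ge0.
have small n : S ((1 + W) / 2 ^+ n) <= B.
  elim: n => [|n IH].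
    apply: le_trans B1; rewrite expr0 divr1.
    apply: (@le_trans _ _ (\sum_(w <- ws) w ^+ 2 / (1 + W) ^+ 2)).
      apply: ler_sum => w _; rewrite ler_wpM2l ?sqr_ge0 // lef_pV2 ?posrE ?lerDl ?sqr_ge0 //.
        by rewrite ltr_wpDr ?sqr_ge0 // exprn_gt0 //; lra.
      by rewrite exprn_gt0 //; lra.
    have W1 : 0 < (1 + W) ^+ 2 by rewrite exprn_gt0 //; lra.
    by rewrite -mulr_suml -/W ler_pdivrMr // mul1r; nra.
  have tn : 0 < (1 + W) / 2 ^+ n by rewrite divr_gt0 ?exprn_gt0 //; lra.
  have -> : (1 + W) / 2 ^+ n.+1 = (1 + W) / 2 ^+ n / 2.
    by rewrite exprS invfM mulrA mulrAC.
  move: IH tn; set t := (1 + W) / 2 ^+ n => IH tn.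
  apply: root_count_gap; first lra.
  apply: (@le_trans _ _ (4 * S t)); last first.
    by move: IH D_large; move: (S t) B (D%:R : R) => s B' D' h1 h2; lra.
  rewrite /S mulr_sumr; apply: ler_sum => w _.
  have t2 : 0 < t ^+ 2 by rewrite exprn_gt0.
  rewrite mulrA ler_pdivrMr; last by have := sqr_ge0 w; nra.
  rewrite mulrAC ler_pdivlMr; last by have := sqr_ge0 w; nra.
  have := sqr_ge0 w; nra.
pose Z := \sum_(w <- ws) (if w == 0 then 0 else w ^- 2).
have Z0 : 0 <= Z.
  by rewrite sumr_ge0 // => w _; case: eqP => // _; rewrite invr_ge0 sqr_ge0.
have low t : 0 < t -> (count (fun w => w != 0) ws)%:R - t ^+ 2 * Z <= S t.
  move=> t0; rewrite -sum1_count big_mkcond natr_sum /Z mulr_sumr -sumrB.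
  apply: ler_sum => w _; have [->|w0] := eqVneq w 0.
    by rewrite expr0n mul0r mulr0 subr0.
  have w2 : 0 < w ^+ 2 by rewrite lt0r sqrf_eq0 w0 sqr_ge0.
  have t2 : 0 < t ^+ 2 by rewrite exprn_gt0.
  rewrite /= ler_pdivlMr; last by lra.
  have -> : (1 - t ^+ 2 / w ^+ 2) * (t ^+ 2 + w ^+ 2) = w ^+ 2 - t ^+ 2 * t ^+ 2 / w ^+ 2.
    by field; rewrite w0.
  by rewrite lerBlDr lerDl divr_ge0 ?sqr_ge0 // mulr_ge0 ?sqr_ge0.
rewrite leNgt; apply/negP; set n := (count _ _)%:R => nB.
(* A power [2^j > K] pushes the error [t^2 Z] below [n - B]. *)
pose K := (1 + W) ^+ 2 * Z / (n - B).
have K0 : 0 <= K by rewrite divr_ge0 ?mulr_ge0 ?sqr_ge0 //; lra.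
have := upper_nthrootP (leqnn (Num.bound K)); set j := Num.bound K => hK.
have tj : 0 < (1 + W) / 2 ^+ j by rewrite divr_gt0 ?exprn_gt0 //; lra.
have h1 := low _ tj; have h2 := small j.
have h3 : n - B <= ((1 + W) / 2 ^+ j) ^+ 2 * Z by rewrite -/n in h1; lra.
have h4 : ((1 + W) / 2 ^+ j) ^+ 2 * Z <= (1 + W) ^+ 2 * Z / 2 ^+ j.
  have P1 : 1 <= 2 ^+ j :> R by rewrite exprn_ege1 ?ler1n.
  have P0 : 0 < 2 ^+ j :> R by lra.
  have -> : ((1 + W) / 2 ^+ j) ^+ 2 * Z = (1 + W) ^+ 2 * Z / 2 ^+ j / 2 ^+ j.
    by field; rewrite gt_eqF.
  by rewrite ler_pdivrMr // ler_peMr // divr_ge0 ?(ltW P0) // mulr_ge0 ?sqr_ge0.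
have : (1 + W) ^+ 2 * Z / 2 ^+ j < n - B.
  by rewrite ltr_pdivrMr ?exprn_gt0 // -ltr_pdivrMl ?subr_gt0 // mulrC.
lra.
Qed.

End RootCount.

(** * Only finitely many [b k] are nonzero *)

Section Finiteness.
Variable R : archiRcfType.
Variables (a : R) (b lam : nat -> R) (k l m : nat).
Local Notation toC := (map_poly (real_complex R)).
Hypothesis a0 : 0 < a.
Hypothesis T_rr : forall N (f : {poly R}), (size f <= N.+1)%N -> rr f -> rr (lop a b N.+1 f).
Hypothesis T_lag : forall N n, (n <= N)%N ->
  lop a b N.+1 (lag (a - 1) n) = lam n *: lag (a - 1) n.
Hypothesis kl : (k.+1 < l)%N.
Hypothesis lamk : lam k != 0.
Hypothesis laml : lam l != 0.
Hypothesis bm : b m != 0.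
Hypothesis bm0 : forall i, (i < m)%N -> b i = 0.

Local Notation q := (fun i => (-1) ^+ i * b i).
Local Notation A N := (ffpoly q N).
Local Notation V N := (ffpoly (bseq a b) N).

Lemma bseq_lt i : (i < m)%N -> bseq a b i = 0.
Proof.
case: i => [|i] im //=; rewrite bm0 ?(ltnW im) // (bm0 im); ring.
Qed.

Lemma bseq_m : bseq a b m = - m%:R * q m.
Proof.
case: m bm0 => [|i] h /=; first by rewrite oppr0 mul0r.
by rewrite h //; ring.
Qed.

(** Adding [m A] to [V] cancels the coefficient of degree [N - m] and changes [V * conj A] by a real
    number only. The right-hand side is the [r] of the root count, with [D = N - m] and
    [be = a - 1 + m]. *)
Lemma ffpoly_relation N : (m <= N)%N ->
  V N + m%:R *: A N = ('X + ((N - m)%:R + (a - 1 + m%:R))%:P) * (A N)^`()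
    - (N - m)%:R *: A N - 'X * (A N)^`()^`().
Proof.
move=> mN; apply/polyP => j; rewrite mulrDl mul_polyC.
rewrite !coefB !coefD !coefZ !coefXM !coef_deriv.
have -> : (if j == 0%N then 0 else (A N)`_j.-1.+1 *+ j.-1.+1) = j%:R * (A N)`_j.
  by case: j => [|j] /=; rewrite ?mul0r // mulr_natl.
have -> : (if j == 0%N then 0 else (A N)`_j.-1.+2 *+ j.-1.+2 *+ j.-1.+1) =
    j%:R * ((A N)`_j.+1 *+ j.+1).
  by case: j => [|j] /=; rewrite ?mul0r // mulr_natl.
rewrite -[_ *+ j.+1]mulr_natr !coef_ffpoly natrB //.
have [jN|jN] := leqP j N; last first.
  by rewrite ltnNge (ltnW jN) /=; ring.
have [jN'|jN'] := ltnP j N; last first.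
  have -> : j = N by apply/anti_leq; rewrite jN jN'.
  rewrite subnn ffactn0 /=; ring.
have -> : (N - j = (N - j.+1).+1)%N by rewrite subnSK.
set i := (N - j.+1)%N.
have Ni : N = (i + j.+1)%N by rewrite subnK.
have -> : (N ^_ i.+1)%:R = (N ^_ i)%:R * j.+1%:R :> R.
  by rewrite -natrM ffactnSr Ni addKn.
have NE : N%:R = i%:R + j%:R + 1 :> R by rewrite {1}Ni natrD -natr1 addrA.
rewrite /= NE -!natr1; ring.
Qed.

Lemma size_A N : (m <= N)%N -> size (A N) = (N - m).+1.
Proof.
move=> mN; apply/anti_leq/andP; split.
  apply/leq_sizeP => j jN; rewrite coef_ffpoly; case: leqP => // jN2.
  by rewrite bm0 ?mulr0 //; lia.
rewrite ltnNge; apply/negP => /leq_sizeP/(_ _ (leqnn _))/eqP.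
rewrite coef_ffpoly leq_subr subKn // !mulf_eq0 signr_eq0 (negPf bm) orbF /=.
by rewrite pnatr_eq0 -leqn0 leqNgt ffact_gt0 mN.
Qed.

(** The coefficient of degree [N - m - 1] of [V + m A], divided by [N - m] and by the leading
    coefficient of [A]; it does not depend on [N]. *)
Let c0 := a + m%:R + b m.+1 / b m.
Let be := a - 1 + m%:R.

(** [pick_bound] and [root_count] leave at most that many nonzero roots among the [N - m] roots of
    [A], so [A] is divisible by [X^(N - m - n)] and its lower coefficients vanish. *)
Lemma few_roots N : (maxn l m.+1 <= N)%N ->
    8 * (2 * (`|c0| + `|be| + 1)) <= (N - m)%:R ->
  exists2 n, n%:R <= 2 * (`|c0| + `|be| + 1) &
    forall i, (m + n < i <= N)%N -> b i = 0.
Proof.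
rewrite geq_max => /andP[lN mN1] large; have mN := ltnW mN1.
have sA : stable (toC (A N)).
  exact: (boundary_stable a0 (T_rr (N := N)) (@T_lag N) kl lN lamk laml mN bm bm0).
have [c [ws AE]] := stable_rr sA.
have szA := size_A mN.
have cn : c != 0.
  by apply: contra_eqN szA => /eqP c00; rewrite AE c00 scale0r size_poly0.
have szw : size ws = (N - m)%N.
  by move: szA; rewrite AE size_scale // size_prod_XsubC => -[].
have [D DE] : exists D, (N - m = D.+1)%N by exists (N - m).-1; rewrite prednK // subn_gt0.
have lA : (A N)`_D.+1 = c.
  have := coef_prod_XsubC; rewrite AE coefZ -DE -szw.
  have /monicP := monic_prod_XsubC ws xpredT id.
  by rewrite lead_coefE size_prod_XsubC => -> _; rewrite mulr1.
pose r := V N + m%:R *: A N.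
have sr : (size r <= D.+1)%N.
  apply/leq_sizeP => j Dj; rewrite coefD coefZ !coef_ffpoly; case: leqP => jN; last by rewrite mulr0 addr0.
  have [Nj|Nj] := ltnP (N - j) m; first by rewrite bseq_lt // bm0 //; ring.
  have -> : (N - j = m)%N by lia.
  by rewrite bseq_m; ring.
have rD : r`_D = (N - m)%:R * c0 * c.
  have ND : (N - D = m.+1)%N by lia.
  have AD : c = (N ^_ m)%:R * q m.
    by rewrite -lA coef_ffpoly -DE leq_subr subKn.
  rewrite coefD coefZ !coef_ffpoly ND; have -> : (D <= N)%N by lia.
  rewrite ffactnSr natrM AD /c0 /= exprS; field.
  exact: bm.
(* Whichever sign [boundary_sign] gives, [r] or [- r] satisfies the hypothesis of [pick_bound], and
   only squares enter the resulting bound. *)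
have pick_r : (forall w, 0 < Im w -> Im ((toC r).[w] * conjc (toC (A N)).[w]) <= 0) \/
    (forall w, 0 < Im w -> Im ((toC (- r)).[w] * conjc (toC (A N)).[w]) <= 0).
  have rw w : Im ((toC r).[w] * conjc (toC (A N)).[w]) =
      Im ((toC (V N)).[w] * conjc (toC (A N)).[w]).
    rewrite /r rmorphD /= map_polyZ hornerD hornerZ mulrDl ImD -mulrA mulcJ -rmorphM /=.
    by rewrite addr0.
  case: (boundary_sign a0 (T_rr (N := N)) (@T_lag N) kl lN lamk laml) => p; [left|right] => w w0.
    by rewrite rw; apply: p.
  by rewrite rmorphN hornerN mulNr ImN oppr_le0 rw; apply: p.
have bnd t : 0 < t -> t ^+ 2 * nsq (toC r).[t%:C * 'i%C] <=
    ((N - m)%:R * c0) ^+ 2 * nsq (toC (A N)).[t%:C * 'i%C].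
  move=> t0; have z0 : 0 < Im (t%:C * 'i%C) by rewrite Im_real /= mulr1.
  have szA' : size (A N) = D.+2 by rewrite szA DE.
  have c2 : 0 < c ^+ 2 by rewrite lt0r sqrf_eq0 cn sqr_ge0.
  rewrite -(ler_pM2l c2) [leLHS](mulrA (c ^+ 2)) [leRHS](mulrA (c ^+ 2)) -!exprMn.
  have Imt : Im (t%:C * 'i%C) = t by rewrite Im_real /= mulr1.
  case: pick_r => pr.
    by have := pick_bound szA' sr sA pr z0; rewrite lA rD Imt [c * (_ * _)]mulrC.
  have sr' : (size (- r) <= D.+1)%N by rewrite size_polyN.
  have := pick_bound szA' sr' sA pr z0; rewrite lA coefN rD Imt sqrrN rmorphN hornerN nsqN.
  by rewrite [c * (_ * _)]mulrC.
have rE := ffpoly_relation mN.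
have := @root_count R ws c be c0 cn; rewrite szw -AE -rE => /(_ bnd large) hcount.
pose n := count (fun w => w != 0) ws.
have nE : (n + count_mem 0%R ws = N - m)%N by rewrite -szw addnC -(count_predC (pred1 0%R)).
exists n => // i /andP[mi iN].
have : (A N)`_(N - i) = 0.
  rewrite AE coefZ coef_prod_XsubC_count0 ?mulr0 //.
  by move: mi iN nE; move: (count_mem _ _) => n'; lia.
rewrite coef_ffpoly leq_subr subKn // => /eqP; rewrite !mulf_eq0 signr_eq0 /= => /orP[|/eqP //].
by rewrite pnatr_eq0 -leqn0 leqNgt ffact_gt0 iN.
Qed.

(** The root bound is independent of [N], so a large enough [N] can be taken for each index [i]. *)
Lemma symbol_finite : exists M, forall i, (M < i)%N -> b i = 0.
Proof.
pose B := 2 * (`|c0| + `|be| + 1).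
have B0 : 0 <= B by rewrite /B; have := normr_ge0 c0; have := normr_ge0 be; lra.
exists (m + Num.bound B)%N => i mi.
pose N := (i + l + m.+1 + Num.bound (8 * B))%N.
have [||n nB h] := @few_roots N.
- by rewrite /N; lia.
- have : 8 * B < (Num.bound (8 * B))%:R by apply: archi_boundP; lra.
  move=> /ltW h; apply: le_trans h _; rewrite ler_nat /N; lia.
apply: h; rewrite (_ : (i <= N)%N) ?andbT; last by rewrite /N; lia.
have : (n < Num.bound B)%N.
  by rewrite -(ltr_nat R); apply: le_lt_trans nB _; apply: archi_boundP.
by move: mi; lia.
Qed.

End Finiteness.

(** * Rescaling by [N], with [1 / N] as a polynomial variable *)

Section Rescaling.
Variable R : rcfType.
Local Notation toC := (map_poly (real_complex R)).
Implicit Types (u : nat -> R) (z : R[i]).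

Lemma eq_rpoly n u u' : (forall i, (i <= n)%N -> u i = u' i) -> rpoly n u = rpoly n u'.
Proof.
by move=> h; apply/polyP => j; rewrite !coef_rpoly; case: leqP => // _; rewrite h ?leq_subr.
Qed.

Lemma rpoly_shift M n u : (M <= n)%N -> (forall i, (M < i)%N -> u i = 0) ->
  rpoly n u = 'X^(n - M) * rpoly M u.
Proof.
move=> Mn h; apply/polyP => j; rewrite coefXnM !coef_rpoly.
have [jn|jn] := leqP j n.
  case: ltnP => jM; first by rewrite h //; lia.
  have -> : (j - (n - M) <= M)%N by lia.
  by congr u; lia.
case: ltnP => // jM; case: leqP => // ?; lia.
Qed.

Lemma horner_rpoly n u z :
  (toC (rpoly n u)).[z] = \sum_(j < n.+1) (u (n - j)%N)%:C * z ^+ j.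
Proof.
rewrite /rpoly poly_def rmorph_sum horner_sum; apply: eq_bigr => j _.
by rewrite /= map_polyZ map_polyXn hornerZ hornerXn.
Qed.

Lemma rpoly_scale n u (s : R) z : s != 0 ->
  (toC (rpoly n u)).[s%:C * z] =
  (s ^+ n)%:C * (toC (rpoly n (fun i => u i / s ^+ i))).[z].
Proof.
move=> s0; rewrite !horner_rpoly mulr_sumr; apply: eq_bigr => j _.
have -> : s ^+ n = s ^+ (n - j) * s ^+ j by rewrite -exprD subnK // -ltnS.
rewrite exprMn -rmorphXn !mulrA -!rmorphM; congr (_%:C * _).
by rewrite /=; field; rewrite expf_neq0.
Qed.

(* pifac i at 1/N is N(N-1)..(N-i+1) / N^i. *)
Definition pifac i : {poly R} := \prod_(j < i) (1 - j%:R *: 'X).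

Lemma horner_pifac i (e : R) : (pifac i).[e] = \prod_(j < i) (1 - j%:R * e).
Proof.
by rewrite horner_prod; apply: eq_bigr => j _; rewrite hornerD hornerN hornerZ hornerX hornerC.
Qed.

Lemma pifac0 i : (pifac i).[0] = 1.
Proof. by rewrite horner_pifac big1 // => j _; rewrite mulr0 subr0. Qed.

Lemma pifac_ffact N i : (0 < N)%N -> (i <= N)%N ->
  (N ^_ i)%:R / N%:R ^+ i = (pifac i).[N%:R^-1].
Proof.
move=> N0; have Nn : N%:R != 0 :> R by rewrite pnatr_eq0 -lt0n.
rewrite horner_pifac; elim: i => [|i IH] iN.
  by rewrite big_ord0 ffactn0 expr0 divr1.
rewrite big_ord_recr /= -IH ?(ltnW iN) // ffactnSr natrM natrB ?(ltnW iN) // exprS.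
by field; rewrite Nn expf_neq0.
Qed.

Lemma pifac_gt0 N i : (0 < N)%N -> (i <= N)%N -> 0 < (pifac i).[N%:R^-1].
Proof.
move=> N0 iN; rewrite -pifac_ffact // divr_gt0 ?exprn_gt0 ?ltr0n //.
by rewrite ffact_gt0.
Qed.

(** Polynomial dependence on [e = 1 / N] makes the limit of large [N] an evaluation at [e = 0],
    within reach of [poly_ge0_limit]. *)
Lemma rpoly_pifac n u z : exists P : {poly R[i]}, forall e,
  (toC (rpoly n (fun i => (pifac i).[e] * u i))).[z] = P.[e%:C].
Proof.
exists (\sum_(j < n.+1) ((u (n - j)%N)%:C * z ^+ j) *: toC (pifac (n - j))) => e.
rewrite horner_rpoly horner_sum; apply: eq_bigr => j _.
by rewrite hornerZ horner_map /= rmorphM; ring.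
Qed.

Lemma Im_mulJ_poly (P Q : {poly R[i]}) : exists g : {poly R}, forall e,
  g.[e] = Im (P.[e%:C] * conjc Q.[e%:C]).
Proof.
exists (Rep (- 'i%C *: (P * conjp Q))) => e.
rewrite horner_Rep hornerZ hornerM horner_conjp conjc_real.
by move: (P.[_] * _) => [x y] /=; ring.
Qed.

End Rescaling.

(** * The sign condition and stability in the limit of large [N] *)

Section Location.
Variable R : archiRcfType.
Variables (a : R) (b lam : nat -> R) (k l m M : nat).
Local Notation toC := (map_poly (real_complex R)).
Hypothesis a0 : 0 < a.
Hypothesis T_rr : forall N (f : {poly R}), (size f <= N.+1)%N -> rr f -> rr (lop a b N.+1 f).
Hypothesis T_lag : forall N n, (n <= N)%N ->
  lop a b N.+1 (lag (a - 1) n) = lam n *: lag (a - 1) n.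
Hypothesis kl : (k.+1 < l)%N.
Hypothesis lamk : lam k != 0.
Hypothesis laml : lam l != 0.
Hypothesis bm : b m != 0.
Hypothesis bm0 : forall i, (i < m)%N -> b i = 0.
Hypothesis bM : b M != 0.
Hypothesis bM0 : forall i, (M < i)%N -> b i = 0.

Local Notation q := (fun i => (-1) ^+ i * b i).
Local Notation v := (bseq a b).
(** At [e = 1 / N], [Be] and [Ce] are [A] and [V] at [N w], divided by powers of [N] and [w]. *)
Local Notation Be e := (rpoly M (fun i => (pifac R i).[e] * q i)).
Local Notation Ce e := (rpoly M.+1 (fun i => (pifac R i).[e] * v i)).

Lemma least_le_degree : (m <= M)%N.
Proof. by rewrite leqNgt; apply: contraNN bM => /bm0 ->. Qed.

Lemma bseq_gt i : (M.+1 < i)%N -> v i = 0.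
Proof.
case: i => //= i iM; rewrite (bM0 (ltnW iM)) bM0 ?mulr0 ?subr0 // -ltnS.
Qed.

Lemma horner_scaled N (w : R[i]) : (M < N)%N ->
  (toC (ffpoly q N)).[N%:R%:C * w] =
    (N%:R ^+ N)%:C * (w ^+ (N - M) * (toC (Be N%:R^-1)).[w]) /\
  (toC (ffpoly v N)).[N%:R%:C * w] =
    (N%:R ^+ N)%:C * (w ^+ (N - M.+1) * (toC (Ce N%:R^-1)).[w]).
Proof.
move=> MN; have N0 : (0 < N)%N by apply: leq_ltn_trans MN.
have Nn : N%:R != 0 :> R by rewrite pnatr_eq0 -lt0n.
have h u L : (L <= N)%N -> (forall i, (L < i)%N -> u i = 0) ->
    (toC (ffpoly u N)).[N%:R%:C * w] =
    (N%:R ^+ N)%:C * (w ^+ (N - L) * (toC (rpoly L (fun i => (pifac R i).[N%:R^-1] * u i))).[w]).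
  move=> LN hu; rewrite /ffpoly rpoly_scale //; congr (_ * _).
  rewrite (@eq_rpoly _ N _ (fun i => (pifac R i).[N%:R^-1] * u i)); last first.
    by move=> i iN; rewrite mulrAC pifac_ffact.
  rewrite (rpoly_shift LN) => [|i /hu ->]; last by rewrite mulr0.
  by rewrite rmorphM /= map_polyXn hornerM hornerXn.
split; apply: h => //; first exact: ltnW.
  by move=> i /bM0 ->; rewrite mulr0.
exact: bseq_gt.
Qed.

(** After rescaling, the behaviour near [w = 0] decides between the two signs of [boundary_sign]. *)
Lemma scaled_sign N : (maxn l M.+1 <= N)%N ->
  stable (toC (Be N%:R^-1)) /\
  forall w : R[i], 0 < Im w -> Im ((toC (Ce N%:R^-1)).[w] * conjc (w * (toC (Be N%:R^-1)).[w])) <= 0.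
Proof.
rewrite geq_max => /andP[lN MN]; have N0 : (0 < N)%N by apply: leq_ltn_trans MN.
have mN : (m <= N)%N by rewrite (leq_trans least_le_degree) // ltnW.
have NR : 0 < N%:R :> R by rewrite ltr0n.
have Imw (w : R[i]) : 0 < Im w -> 0 < Im (N%:R%:C * w) by move=> w0; rewrite Im_real mulr_gt0.
have wn (w : R[i]) : 0 < Im w -> w != 0 by move=> w0; apply: Im_neq0; rewrite gt_eqF.
split.
  have sA := boundary_stable a0 (T_rr (N := N)) (@T_lag N) kl lN lamk laml mN bm bm0.
  move=> w w0; have := sA _ (Imw w w0); have [-> _] := horner_scaled w MN.
  by rewrite !mulf_eq0 !negb_or => /and3P[].
have key (w : R[i]) : 0 < Im w -> exists2 c, 0 < c &
    Im ((toC (ffpoly v N)).[N%:R%:C * w] * conjc (toC (ffpoly q N)).[N%:R%:C * w]) =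
    c * Im ((toC (Ce N%:R^-1)).[w] * conjc (w * (toC (Be N%:R^-1)).[w])).
  move=> w0; have [-> ->] := horner_scaled w MN.
  exists ((N%:R ^+ N) ^+ 2 * nsq (w ^+ (N - M.+1))).
    by rewrite mulr_gt0 ?exprn_gt0 // nsq_gt0 expf_neq0 // wn.
  rewrite -Im_real; congr (Im _); rewrite (rmorphM (real_complex R)) /= -mulcJ -(subnSK MN) exprS.
  rewrite !(rmorphM (@conjc R)) /= -[_ -i* 0]/(conjc (N%:R ^+ N)%:C) conjc_real !(rmorphXn (real_complex R)) /=; ring.
case: (boundary_sign a0 (T_rr (N := N)) (@T_lag N) kl lN lamk laml) => h w w0.
  have [c cp e] := key w w0; have := h _ (Imw w w0); rewrite e.
  by rewrite pmulr_rle0.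
(* The other sign would give [Re (Ce * conj Be) <= 0] on the positive imaginary axis, hence at 0,
   where it is a positive multiple of [(a + M) q_M^2]. *)
exfalso.
have h' (t : R) : 0 < t -> Re ((toC (Ce N%:R^-1)).[t%:C * 'i%C] *
    conjc (toC (Be N%:R^-1)).[t%:C * 'i%C]) <= 0.
  move=> t0; have ti : 0 < Im (t%:C * 'i%C) by rewrite Im_real /= mulr1.
  have [c cp e] := key _ ti; have := h _ (Imw _ ti); rewrite e pmulr_rge0 //.
  rewrite (rmorphM (@conjc R)) /= mulrCA; move: (_ * conjc _) => -[x y] /=.
  by move=> hh; have : 0 <= - (t * x) by [lra|nra]; rewrite oppr_ge0 pmulr_rle0.
have [g hg] : exists g : {poly R}, forall t, g.[t] =
    - Re ((toC (Ce N%:R^-1)).[t%:C * 'i%C] * conjc (toC (Be N%:R^-1)).[t%:C * 'i%C]).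
  pose P := toC (Ce N%:R^-1) \Po ('i%C *: 'X); pose Q := toC (Be N%:R^-1) \Po ('i%C *: 'X).
  exists (Rep (- (P * conjp Q))) => t.
  rewrite horner_Rep hornerN hornerM horner_conjp conjc_real ReN /P /Q !horner_comp.
  by rewrite hornerZ hornerX mulrC [t%:C * _]mulrC mulrC.
have : 0 <= g.[0].
  apply: poly_ge0_limit => d d0; exists (d / 2); split; [lra|lra|].
  by rewrite hg oppr_ge0; apply: h'; lra.
rewrite hg mul0r !horner_coef0 !coef_map conjc_real -rmorphM /= !coef_rpoly /= !subn0.
rewrite (bM0 (ltnSn M)) !mulr0 subr0 oppr_ge0 leNgt => /negP; apply.
have p1 := pifac_gt0 R N0 MN; have p2 := pifac_gt0 R N0 (ltnW MN).
have -> : (pifac R M.+1).[N%:R^-1] * ((a + M%:R) * q M) * ((pifac R M).[N%:R^-1] * q M) =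
   (pifac R M.+1).[N%:R^-1] * (pifac R M).[N%:R^-1] * (a + M%:R) * (q M) ^+ 2 by ring.
apply: mulr_gt0; last by rewrite lt0r sqrf_eq0 sqr_ge0 mulf_neq0 ?signr_eq0.
by apply: mulr_gt0; [apply: mulr_gt0 | rewrite ltr_wpDr].
Qed.

Lemma small_inverse (d : R) : 0 < d ->
  exists N, [/\ (maxn l M.+1 <= N)%N, 0 < N%:R^-1 :> R & N%:R^-1 < d].
Proof.
move=> d0; pose N := (maxn l M.+1 + Num.bound d^-1)%N; exists N.
have hN : (maxn l M.+1 <= N)%N by rewrite leq_addr.
have N0 : 0 < N%:R :> R.
  by rewrite ltr0n (leq_trans _ hN) // leq_max orbT.
split => //; first by rewrite invr_gt0.
rewrite -[d]invrK ltf_pV2 ?posrE ?invr_gt0 //.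
have := archi_boundP (ltW (_ : 0 < d^-1)); rewrite invr_gt0 => /(_ d0) h.
by apply: lt_le_trans h _; rewrite ler_nat leq_addl.
Qed.

(** The coefficient of degree [M - m] of [Be e] is [(pifac R m).[e] * q m], nonzero also at [e = 0],
    so the bound of [stable_coef_bound] passes to the limit. *)
Lemma limit_stable : stable (toC (rpoly M q)).
Proof.
move=> w w0; have [P hP] := rpoly_pifac M q w.
have P0 : (toC (rpoly M q)).[w] = P.[0].
  rewrite -(rmorph0 (real_complex R)) -hP; congr (_.[w]); congr (map_poly _ _).
  by apply: eq_rpoly => i _; rewrite pifac0 mul1r.
have [g hg] := nsq_poly P 0 1.
pose G := g - (Im w ^+ 2 ^+ (M - m) * q m ^+ 2) *: pifac R m ^+ 2.
have : 0 <= G.[0].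
  apply: poly_ge0_limit => d d0; have [N [hN N0 Nd]] := small_inverse d0.
  exists N%:R^-1; split => //.
  have [sB _] := scaled_sign hN.
  rewrite hornerD hornerN hornerZ horner_exp hg add0r mulr1 -hP subr_ge0.
  have szB : (size (toC (Be N%:R^-1)) <= (M - m).+1)%N.
    rewrite size_map_poly; apply/leq_sizeP => j hj; rewrite coef_rpoly.
    by case: leqP => // jM; rewrite bm0 ?mulr0 //; move: least_le_degree; lia.
  apply: le_trans (stable_coef_bound sB szB w0).
  rewrite coef_map nsq_real coef_rpoly leq_subr subKn ?least_le_degree //.
  by rewrite le_eqVlt; apply/orP; left; apply/eqP; ring.
have z0 : 0 + (0 : R)%:C * 1 = 0 :> R[i] by rewrite mulr1 add0r.
rewrite hornerD hornerN hornerZ horner_exp hg z0 pifac0 expr1n mulr1 -P0 subr_ge0.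
move=> h; rewrite -nsq_gt0; apply: lt_le_trans h.
apply: mulr_gt0; first by rewrite !exprn_gt0.
by rewrite lt0r sqrf_eq0 sqr_ge0 andbT mulf_neq0 ?signr_eq0.
Qed.

Lemma limit_sign (w : R[i]) : 0 < Im w ->
  Im ((toC (rpoly M.+1 v)).[w] * conjc (w * (toC (rpoly M q)).[w])) <= 0.
Proof.
move=> w0; have [P hP] := rpoly_pifac M q w; have [Q hQ] := rpoly_pifac M.+1 v w.
have P0 : (toC (rpoly M q)).[w] = P.[0].
  rewrite -(rmorph0 (real_complex R)) -hP; congr (_.[w]); congr (map_poly _ _).
  by apply: eq_rpoly => i _; rewrite pifac0 mul1r.
have Q0 : (toC (rpoly M.+1 v)).[w] = Q.[0].
  rewrite -(rmorph0 (real_complex R)) -hQ; congr (_.[w]); congr (map_poly _ _).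
  by apply: eq_rpoly => i _; rewrite pifac0 mul1r.
have [g hg] := Im_mulJ_poly Q (w *: P).
have : 0 <= (- g).[0].
  apply: poly_ge0_limit => d d0; have [N [hN N0 Nd]] := small_inverse d0.
  exists N%:R^-1; split => //.
  by rewrite hornerN hg hornerZ -hP -hQ oppr_ge0; apply: (scaled_sign hN).2.
by rewrite hornerN hg hornerZ rmorph0 -P0 -Q0 oppr_ge0.
Qed.

End Location.

(** * Location of the zeros of [p] *)

Section Location.
Variable R : archiRcfType.
Variables (a : R) (b lam : nat -> R) (k l m M : nat).
Local Notation toC := (map_poly (real_complex R)).
Hypothesis a0 : 0 < a.
Hypothesis T_rr : forall N (f : {poly R}), (size f <= N.+1)%N -> rr f -> rr (lop a b N.+1 f).
Hypothesis T_lag : forall N n, (n <= N)%N ->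
  lop a b N.+1 (lag (a - 1) n) = lam n *: lag (a - 1) n.
Hypothesis kl : (k.+1 < l)%N.
Hypothesis lamk : lam k != 0.
Hypothesis laml : lam l != 0.
Hypothesis bm : b m != 0.
Hypothesis bm0 : forall i, (i < m)%N -> b i = 0.
Hypothesis bM : b M != 0.
Hypothesis bM0 : forall i, (M < i)%N -> b i = 0.

Local Notation q := (fun i => (-1) ^+ i * b i).
Local Notation v := (bseq a b).

Lemma limit_relation : rpoly M.+1 v =
  ((M%:R + a)%:P - M%:R *: 'X) * rpoly M q + 'X * ('X - 1) * (rpoly M q)^`().
Proof.
have -> : 'X * ('X - 1) * (rpoly M q)^`() =
    'X * ('X * (rpoly M q)^`()) - 'X * (rpoly M q)^`() by ring.
apply/polyP => j; rewrite mulrBl mul_polyC -scalerAl coefD !coefB !coefZ !coefXM !coef_deriv.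
have -> : (if j == 0%N then 0 else (rpoly M q)`_j.-1.+1 *+ j.-1.+1) = j%:R * (rpoly M q)`_j.
  by case: j => [|j] /=; rewrite ?mul0r // mulr_natl.
rewrite !coef_rpoly; case: j => [|j] /=.
  by rewrite !subn0 /= (bM0 (ltnSn M)); ring.
have -> : (if j == 0%N then 0 else (if (j.-1 < M)%N then q (M - j.-1.+1)%N else 0) *+ j.-1.+1) =
    j%:R * (if (j <= M)%N then q (M - j)%N else 0).
  by case: j => [|j] /=; rewrite ?mul0r // mulr_natl.
rewrite subSS ltnS; have [jM|jM] := ltnP j M; last first.
  case: leqP => jM'; last by ring.
  have -> : j = M by apply/anti_leq; rewrite jM jM'.
  by rewrite subnn /=; ring.
rewrite (ltnW jM); have -> : (M - j = (M - j.+1).+1)%N by rewrite subnSK.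
set i := (M - j.+1)%N; have NE : M%:R = i%:R + j%:R + 1 :> R.
  by rewrite -natrD natr1 -addnS /i subnK.
by rewrite /= NE -!natr1; ring.
Qed.

(* Evaluate the sign condition at w = r + i t and let t tend to 0: the term (1 - r) / t of the root r
   itself dominates. *)
Lemma limit_roots_ge1 c (rs : seq R) : c != 0 ->
  rpoly M q = c *: \prod_(r <- rs) ('X - r%:P) -> {in rs, forall r, 1 <= r}.
Proof.
move=> cn BE r rrs; rewrite leNgt; apply/negP => r1.
have rn : r != 0.
  apply: contraNneq bM => r0; have : (rpoly M q).[0] = 0.
    by rewrite BE hornerZ horner_prod_XsubC (big_rem r rrs) /= r0 subrr mul0r mulr0.
  rewrite horner_coef0 coef_rpoly subn0 => /eqP.
  by rewrite mulf_eq0 signr_eq0.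
have r2 : 0 < r ^+ 2 by rewrite lt0r sqrf_eq0 rn sqr_ge0.
pose cs := [seq s%:C | s <- rs].
have BC : toC (rpoly M q) = c%:C *: \prod_(s <- cs) ('X - s%:P).
  rewrite BE map_polyZ rmorph_prod big_map; congr (_ *: _); apply: eq_bigr => s _.
  by rewrite rmorphB /= map_polyX map_polyC.
(* The sign condition for the quotient at [w = r + i t], multiplied by [t] so that each term of the
   root [r] itself becomes [1 - r]. *)
have key (t : R) : 0 < t -> \sum_(s <- rs) (1 - s) * t ^+ 2 / ((r - s) ^+ 2 + t ^+ 2) <=
    (M%:R + a) * t ^+ 2 / (r ^+ 2 + t ^+ 2).
  move=> t0; pose w : R[i] := r +i* t; have w0 : 0 < Im w by [].
  have wn : w != 0 by apply: Im_neq0; rewrite gt_eqF.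
  have t2 : 0 < t ^+ 2 by rewrite exprn_gt0.
  have wcs : w \notin cs.
    by apply/negP => /mapP[s _ /(congr1 (@complex.Im R)) /= tE]; rewrite tE ltxx in t0.
  have Bw := limit_stable a0 T_rr T_lag kl lamk laml bm bm0 bM bM0 w0.
  have B1 : (toC (rpoly M q))^`().[w] = (toC (rpoly M q)).[w] * \sum_(s <- cs) (w - s)^-1.
    by rewrite BC derivZ !hornerZ logderiv_prod // mulrA.
  have := limit_sign a0 T_rr T_lag kl lamk laml bm bm0 bM bM0 w0.
  have nw : 0 < nsq (w * (toC (rpoly M q)).[w]) by rewrite nsq_gt0 mulf_neq0.
  have -> : (toC (rpoly M.+1 v)).[w] = w * (toC (rpoly M q)).[w] *
      ((M%:R + a)%:C / w - (M%:R)%:C + (w - 1) * \sum_(s <- cs) (w - s)^-1).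
    rewrite limit_relation rmorphD !rmorphM !rmorphB /= map_polyC map_polyZ map_polyX rmorph1.
    rewrite hornerD !hornerM !hornerD !hornerN !hornerZ hornerX !hornerC -deriv_map B1 /=.
    by field.
  rewrite mulrAC mulcJ Im_real pmulr_rle0 // => h.
  have : t * Im ((M%:R + a)%:C / w - (M%:R)%:C + (w - 1) * \sum_(s <- cs) (w - s)^-1) <= 0.
    by rewrite pmulr_rle0.
  rewrite ImD ImD ImN Im_real Im_inv /= oppr0 addr0 mulr_sumr Im_sum big_map.
  have -> : \sum_(s <- rs) Im ((w - 1) * (w - s%:C)^-1) =
      \sum_(s <- rs) (1 - s) * t / ((r - s) ^+ 2 + t ^+ 2).
    apply: eq_bigr => s _; rewrite ImM Im_inv Re_inv /nsq /= subr0.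
    have h2 : (r - s) ^+ 2 + t ^+ 2 != 0 by rewrite gt_eqF // ltr_wpDl ?sqr_ge0.
    by field.
  rewrite mulrDr mulr_sumr => h3.
  have -> : \sum_(s <- rs) (1 - s) * t ^+ 2 / ((r - s) ^+ 2 + t ^+ 2) =
      \sum_(s <- rs) t * ((1 - s) * t / ((r - s) ^+ 2 + t ^+ 2)).
    by apply: eq_bigr => s _; ring.
  have -> : (M%:R + a) * t ^+ 2 / (r ^+ 2 + t ^+ 2) = - (t * ((M%:R + a) * (- t / nsq w))).
    by rewrite /nsq /=; ring.
  by lra.
pose Z := \sum_(s <- rs) (if s == r then 0 else `|1 - s| / (r - s) ^+ 2).
have Z0 : 0 <= Z.
  by apply: sumr_ge0 => s _; case: eqP => // _; rewrite divr_ge0 ?sqr_ge0.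
have low (t : R) : 0 < t -> (1 - r) - t ^+ 2 * Z <=
    \sum_(s <- rs) (1 - s) * t ^+ 2 / ((r - s) ^+ 2 + t ^+ 2).
  move=> t0; have t2 : 0 < t ^+ 2 by rewrite exprn_gt0.
  have term s : (if s == r then 1 - r else 0) - t ^+ 2 * (if s == r then 0 else `|1 - s| / (r - s) ^+ 2) <=
      (1 - s) * t ^+ 2 / ((r - s) ^+ 2 + t ^+ 2).
    have [->|sr] := eqVneq s r.
      by rewrite mulr0 subr0 subrr expr0n add0r mulfK // gt_eqF.
    have d2 : 0 < (r - s) ^+ 2 by rewrite lt0r sqrf_eq0 subr_eq0 eq_sym sr sqr_ge0.
    rewrite sub0r; apply: le_trans (_ : - (`|1 - s| * t ^+ 2 / ((r - s) ^+ 2 + t ^+ 2)) <= _).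
      rewrite lerN2 [leLHS]mulrAC [leRHS]mulrC ler_wpM2r ?(ltW t2) // ler_wpM2l //.
      by rewrite lef_pV2 ?posrE ?lerDl ?(ltW t2) // ltr_wpDr // ltW.
    rewrite -!mulNr ler_wpM2r ?invr_ge0 ?addr_ge0 ?sqr_ge0 // ler_wpM2r ?sqr_ge0 //.
    by rewrite lerNl -normrN ler_norm.
  apply: le_trans (_ : \sum_(s <- rs) ((if s == r then 1 - r else 0) -
      t ^+ 2 * (if s == r then 0 else `|1 - s| / (r - s) ^+ 2)) <= _); last by apply: ler_sum.
  rewrite sumrB -mulr_sumr -/Z lerB // (big_rem r rrs) /= eqxx lerDl sumr_ge0 // => s _.
  by case: eqP => // _; lra.
pose K := Z + (M%:R + a) / r ^+ 2.
have K0 : 0 <= K by rewrite addr_ge0 // divr_ge0 ?sqr_ge0 // addr_ge0 ?ler0n // ltW.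
(* Then [t <= 1] and [t (2 - r + K) = 1 - r], so [t^2 K <= t K < 1 - r]. *)
pose t := (1 - r) / (1 - r + (K + 1)).
have den : 0 < 1 - r + (K + 1) by lra.
have t0 : 0 < t by rewrite divr_gt0 //; lra.
have t1 : t <= 1 by rewrite ler_pdivrMr // mul1r; lra.
have tK : t * (1 - r + (K + 1)) = 1 - r by rewrite /t divfK // gt_eqF.
have h := le_trans (low t t0) (key t t0).
have h2 : (M%:R + a) * t ^+ 2 / (r ^+ 2 + t ^+ 2) <= t ^+ 2 * ((M%:R + a) / r ^+ 2).
  rewrite mulrAC [leRHS]mulrC ler_wpM2r ?sqr_ge0 // ler_wpM2l ?addr_ge0 ?ler0n ?(ltW a0) //.
  by rewrite lef_pV2 ?posrE ?lerDl ?sqr_ge0 // ltr_wpDr ?sqr_ge0.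
have : 1 - r <= t ^+ 2 * K by rewrite /K mulrDr; lra.
by rewrite expr2; nra.
Qed.

(** With [B = rpoly M q], [p y = (- y)^M B(- 1 / y)] for [y != 0]. As [B] has degree [M - m], a
    factor [(- y)^m] is left over and gives the zeros at 0. *)
Lemma symbol_factor : exists c rs, {in rs, forall r, -1 <= r <= 0} /\
  forall y, \sum_(i < M.+1) b i * y ^+ i = c * \prod_(r <- rs) (y - r).
Proof.
have sB := limit_stable a0 T_rr T_lag kl lamk laml bm bm0 bM bM0.
have [c [rs BE]] := stable_rr sB.
have cn : c != 0.
  apply: contraNneq bM => c00; have : (rpoly M q)`_0 = 0 by rewrite BE c00 scale0r coef0.
  by rewrite coef_rpoly subn0 => /eqP; rewrite mulf_eq0 signr_eq0.
have rs1 := limit_roots_ge1 cn BE.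
have mM := least_le_degree bm0 bM.
have sz : size rs = (M - m)%N.
  have : size (rpoly M q) = (M - m).+1.
    apply/anti_leq/andP; split.
      apply/leq_sizeP => j hj; rewrite coef_rpoly; case: leqP => // jM.
      by rewrite bm0 ?mulr0 //; lia.
    rewrite ltnNge; apply/negP => /leq_sizeP/(_ _ (leqnn _))/eqP.
    by rewrite coef_rpoly leq_subr subKn // mulf_eq0 signr_eq0 (negPf bm).
  by rewrite BE size_scale // size_prod_XsubC => -[].
(* Each root [r] of [B] contributes [(- y) (- 1 / y - r) = r (y + 1 / r)]. *)
exists (c * (-1) ^+ m * \prod_(r <- rs) r), (nseq m 0 ++ [seq - r^-1 | r <- rs]); split.
  move=> r; rewrite mem_cat mem_nseq => /orP[/andP[_ /eqP ->]|/mapP[s /rs1 s1 ->]].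
    by rewrite lexx oppr_le0 ler01.
  by rewrite lerN2 oppr_le0 invf_le1 ?invr_ge0; lra.
move=> y; rewrite big_cat big_map big_nseq iter_mulr mulr1 subr0 /=.
have [->|y0] := eqVneq y 0.
  rewrite big_ord_recl big1 ?addr0 => [|i _]; last by rewrite lift0 expr0n mulr0.
  rewrite expr0 mulr1; have [m0|m0] := posnP m; last by rewrite bm0 // expr0n gtn_eqF // mul0r mulr0.
  rewrite m0 !expr0 mulr1 mul1r -mulrA -big_split big1_seq ?mulr1; last first.
    move=> r /andP[_ /rs1 r1] /=; rewrite sub0r opprK mulfV // gt_eqF //.
    by apply: lt_le_trans r1.
  have := coef_rpoly M q M; rewrite leqnn subnn expr0 mul1r => <-.
  have sM : size rs = M by rewrite sz m0 subn0.
  have /monicP := monic_prod_XsubC rs xpredT id.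
  by rewrite lead_coefE size_prod_XsubC /= sM BE coefZ => ->; rewrite mulr1.
have -> : \sum_(i < M.+1) b i * y ^+ i = (- y) ^+ M * (rpoly M q).[- y^-1].
  rewrite horner_poly mulr_sumr (reindex_inj rev_ord_inj); apply: eq_bigr => j _ /=.
  rewrite subSS -[in (- y) ^+ M](subnK (ltnSE (ltn_ord j))) exprD -mulrA.
  have -> : (- y) ^+ j * ((-1) ^+ (M - j) * b (M - j)%N * (- y^-1) ^+ j) = (-1) ^+ (M - j) * b (M - j)%N.
    by rewrite mulrCA -exprMn mulrNN divff // expr1n mulr1.
  by rewrite mulrA -exprMn mulrN1 opprK mulrC.
rewrite BE hornerZ horner_prod_XsubC -{1}(subnK mM) exprD -sz.
have e : (- y) ^+ size rs * \prod_(r <- rs) (- y^-1 - r) =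
    \prod_(r <- rs) r * \prod_(r <- rs) (y - - r^-1).
  have : {in rs, forall r, r != 0} by move=> r /rs1 r1; apply: lt0r_neq0; lra.
  elim: (rs) => [|r rs' IH] hr; first by rewrite !big_nil expr0.
  have r0 := hr r (mem_head _ _).
  rewrite !big_cons /= exprS mulrACA IH => [|s sr]; last by apply: hr; rewrite inE sr orbT.
  by field; rewrite y0 r0.
have -> : (- y) ^+ size rs * (- y) ^+ m * (c * \prod_(r <- rs) (- y^-1 - r)) =
   (- y) ^+ m * c * ((- y) ^+ size rs * \prod_(r <- rs) (- y^-1 - r)) by ring.
rewrite e (exprNn y).
by move: ((-1) ^+ m) (y ^+ m) (\prod_(r <- rs) r) (\prod_(r <- rs) _) => *; ring.
Qed.

End Location.

Lemma horner_inj (K : numDomainType) (p q : {poly K}) : (forall x, p.[x] = q.[x]) -> p = q.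
Proof.
move=> pq; apply/eqP; rewrite -subr_eq0; apply: contraT => d0.
pose rs := [seq i%:R : K | i <- iota 0 (size (p - q))].
suff : (size rs < size (p - q)%R)%N by rewrite size_map size_iota ltnn.
apply: max_poly_roots => //.
  by apply/allP => x _; rewrite /root hornerD hornerN pq subrr.
by rewrite map_inj_uniq ?iota_uniq //; apply: mulrIn; rewrite oner_eq0.
Qed.

(** * Both directions of the equivalence, for Laguerre expansions *)

Section Multiplier.
Variable R : archiRcfType.
Variables (al : R) (cs : nat -> R).
Hypothesis al1 : -1 < al.

Let lam n := \sum_(k < n.+1) cs k * 'C(n, k)%:R.
Let b k := poch (al + 1) k / k`!%:R * cs k.
Let T N (f : nat -> R) := \sum_(n < N.+1) (lam n * f n) *: lag al n.

Lemma shift_neq0 j : al + 1 + j%:R != 0.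
Proof. by apply: lt0r_neq0; rewrite ltr_wpDr // -ltrBlDr sub0r. Qed.

Lemma poch_shift_neq0 i : poch (al + 1) i != 0.
Proof. by apply/prodf_neq0 => j _; apply: shift_neq0. Qed.

Lemma binom_sum_widen N n : (n <= N)%N ->
  \sum_(k < N.+1) cs k * 'C(n, k)%:R = lam n.
Proof.
move=> nN; rewrite /lam [RHS](big_ord_widen N.+1 (fun k => cs k * 'C(n, k)%:R)) //.
rewrite [RHS]big_mkcond; apply: eq_bigr => k _; case: ltnP => // nk.
by rewrite bin_small ?mulr0.
Qed.

Lemma lop_lam N (f : nat -> R) :
  lop (al + 1) b N.+1 (\sum_(n < N.+1) f n *: lag al n) = T N f.
Proof.
rewrite lop_sum; apply: eq_bigr => n _; rewrite lopZ lop_eigen //; last exact: shift_neq0.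
by rewrite binom_sum_widen ?leq_ord // scalerA mulrC.
Qed.

Lemma size_lag n : size (lag al n) = n.+1.
Proof.
apply/anti_leq; rewrite size_poly /= ltnNge; apply/negP => /leq_sizeP/(_ n (leqnn n))/eqP.
by apply/negP; rewrite lag_coef_neq0.
Qed.

(** Allows the hypothesis on Laguerre expansions to be applied to every polynomial. *)
Lemma lag_span N (p : {poly R}) : (size p <= N)%N ->
  exists f : nat -> R, p = \sum_(n < N) f n *: lag al n.
Proof.
elim: N p => [|N IH] p.
  by rewrite leqn0 size_poly_eq0 => /eqP ->; exists (fun=> 0); rewrite big_ord0.
move=> sp; pose x := p`_N / (lag al N)`_N.
have [|f fE] := IH (p - x *: lag al N).
  apply/leq_sizeP => j; rewrite leq_eqVlt coefB coefZ => /predU1P[<-|Nj].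
    by rewrite divfK ?subrr // lag_coef_neq0.
  by rewrite !nth_default ?mulr0 ?subr0 // ?size_lag // (leq_trans sp).
exists (fun n => if n == N then x else f n); rewrite big_ord_recr /= eqxx.
rewrite -[LHS](subrK (x *: lag al N)) fE; congr (_ + _).
by apply: eq_bigr => n _; rewrite ltn_eqF.
Qed.

(** [m] and [M] are the least and the largest index of a nonzero [b]: one exists because
    [lam l != 0], and there is a largest by [symbol_finite]. *)
Lemma multiplier_necessary k l : (k.+1 < l)%N -> lam k != 0 -> lam l != 0 ->
    (forall N (f : nat -> R), rr (\sum_(n < N.+1) f n *: lag al n) -> rr (T N f)) ->
  exists M, (forall i, (M < i)%N -> b i = 0) /\
    exists c rs, {in rs, forall r : R, -1 <= r <= 0} /\
      forall y, \sum_(i < M.+1) b i * y ^+ i = c * \prod_(r <- rs) (y - r).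
Proof.
move=> kl lamk laml T_rr.
have a0 : 0 < al + 1 by rewrite -ltrBlDr sub0r.
have b_neq0 i : cs i != 0 -> b i != 0.
  by move=> ?; rewrite !mulf_neq0 ?invr_eq0 ?factr_neq0 ?poch_shift_neq0.
have exm : exists i, b i != 0.
  have [/existsP[i /b_neq0 ?]|/existsPn h] := boolP [exists i : 'I_l.+1, cs i != 0].
    by exists i.
  move: laml; rewrite /lam big1 ?eqxx // => i _.
  by have := h i; rewrite negbK => /eqP ->; rewrite mul0r.
case: (ex_minnP exm) => m bm mmin.
have bm0 i : (i < m)%N -> b i = 0.
  by move=> im; apply/eqP; apply: contraTT im => /mmin; rewrite leqNgt.
have lop_rr N (f : {poly R}) : (size f <= N.+1)%N -> rr f -> rr (lop (al + 1) b N.+1 f).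
  by case/lag_span => g ->; rewrite lop_lam; apply: T_rr.
have lop_eig N n : (n <= N)%N ->
    lop (al + 1) b N.+1 (lag (al + 1 - 1) n) = lam n *: lag (al + 1 - 1) n.
  move=> nN; rewrite addrK lop_eigen; last exact: shift_neq0.
  by rewrite binom_sum_widen.
have [M0 hM0] := symbol_finite a0 lop_rr lop_eig kl lamk laml bm bm0.
have leM0 i : b i != 0 -> (i <= M0)%N.
  by rewrite leqNgt; apply: contraNN => /hM0 ->.
case: (ex_maxnP exm leM0) => M bM Mmax.
have bM0 i : (M < i)%N -> b i = 0.
  by move=> Mi; apply/eqP; apply: contraTT Mi => /Mmax; rewrite -leqNgt.
exists M; split => //.
exact: symbol_factor a0 lop_rr lop_eig kl lamk laml bm bm0 bM bM0.
Qed.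

(** The truncation orders of [p] and of the expansion are first raised to their maximum. [rr_lop] is
    applied to [p (- y)], whose roots are the [- r]; hence the factor [(-1) ^+ size rs]. *)
Lemma multiplier_sufficient M c (rs : seq R) :
    (forall i, (M < i)%N -> b i = 0) -> {in rs, forall r : R, -1 <= r <= 0} ->
    (forall y, \sum_(i < M.+1) b i * y ^+ i = c * \prod_(r <- rs) (y - r)) ->
  forall N (f : nat -> R), rr (\sum_(n < N.+1) f n *: lag al n) -> rr (T N f).
Proof.
move=> bM0 rs01 bE N f.
pose N' := maxn M N; have NN' : (N.+1 <= N'.+1)%N by rewrite ltnS leq_maxr.
pose g n := if (n < N.+1)%N then f n else 0.
have widen (h : nat -> R) : \sum_(n < N.+1) (h n * f n) *: lag al n =
    \sum_(n < N'.+1) (h n * g n) *: lag al n.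
  rewrite (big_ord_widen N'.+1 (fun n => (h n * f n) *: lag al n)) // big_mkcond.
  by apply: eq_bigr => n _; rewrite /g; case: ifP; rewrite ?mulr0 ?scale0r.
have -> : \sum_(n < N.+1) f n *: lag al n = \sum_(n < N'.+1) g n *: lag al n.
  have := widen (fun=> 1); under eq_bigr do rewrite mul1r.
  by under [RHS]eq_bigr do rewrite mul1r.
rewrite /T widen -/(T N' g) -lop_lam.
have a0 : 0 < al + 1 by rewrite -ltrBlDr sub0r.
apply: (@rr_lop _ _ _ _ (c * (-1) ^+ size rs) [seq - r | r <- rs]) => //; last first.
  by move=> s /mapP[r /rs01 r01 ->]; lra.
apply: horner_inj => y; rewrite hornerZ horner_prod_XsubC big_map horner_poly.
have -> : \sum_(i < N'.+1) (-1) ^+ i * b i * y ^+ i = \sum_(i < M.+1) b i * (- y) ^+ i.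
  rewrite (big_ord_widen N'.+1 (fun i => b i * (- y) ^+ i)) ?ltnS ?leq_maxl //.
  rewrite [RHS]big_mkcond; apply: eq_bigr => i _; case: ltnP => iM.
    by rewrite (exprNn y); ring.
  by rewrite bM0 // mulr0 mul0r.
rewrite bE -mulrA; congr (_ * _); elim: (rs) => [|r rs' IH].
  by rewrite !big_nil expr0 mulr1.
by rewrite !big_cons IH /= exprS; ring.
Qed.

End Multiplier.

(** * Translation to the definitions of the statement *)

Local Notation R := Rdefinitions.R.

Lemma sum_f_R0_ord (f : nat -> R) n : sum_f_R0 f n = \sum_(k < n.+1) f k.
Proof. by rewrite sum_f_R0E big_mkord. Qed.

Lemma gbinomE (t : R) j : gbinom t j = gb t j.
Proof.
elim: j => [|j IH]; first by rewrite gb0.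
by rewrite gbS -IH -!INRE.
Qed.

Lemma LaguerreE (alpha : R) n x : Laguerre alpha n x = (lag alpha n).[x].
Proof.
rewrite /Laguerre sum_f_R0_ord horner_poly; apply: eq_bigr => k _.
rewrite gbinomE RpowE !INRE factE RoppE (exprNn x) RdivE !RmultE RplusE minusE; ring.
Qed.

Lemma Laguerre_sumE (alpha : R) (c : nat -> R) N x :
  sum_f_R0 (fun n => Rmult (c n) (Laguerre alpha n x)) N =
  (\sum_(n < N.+1) c n *: lag alpha n).[x].
Proof.
rewrite sum_f_R0_ord horner_sum; apply: eq_bigr => n _.
by rewrite LaguerreE hornerZ.
Qed.

Lemma prodl_map (f : R -> R) rs : prodl (List.map f rs) = \prod_(r <- rs) f r.
Proof. by elim: rs => [|r rs IH]; rewrite ?big_nil // big_cons -IH. Qed.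

Lemma In_mem (r : R) rs : List.In r rs <-> r \in rs.
Proof.
elim: rs => [|s rs IH] //=; rewrite inE; split.
  by case=> [->|/IH ->]; rewrite ?eqxx ?orbT.
by case/predU1P => [->|/IH]; [left|right].
Qed.

Lemma real_rooted_horner (f : R -> R) (p : {poly R}) : (forall x, f x = p.[x]) ->
  real_rooted f <-> rr p.
Proof.
move=> fp; split=> -[c [rs h]]; exists c, rs.
  by apply: horner_inj => x; rewrite -fp h prodl_map hornerZ horner_prod_XsubC.
by move=> x; rewrite fp h prodl_map hornerZ horner_prod_XsubC.
Qed.

(** The bound on [k] matters: beyond it truncated subtraction makes [Binomial.C n k] equal to
    [n! / k!] instead of 0. *)
Lemma C_bin (n k : nat) : (k <= n)%N -> Binomial.C n k = 'C(n, k)%:R.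
Proof.
move=> kn; rewrite /Binomial.C !INRE !factE RdivE RmultE -(bin_fact kn) !natrM.
have := factr_neq0 R k; have := factr_neq0 R (n - k); move=> h1 h2.
by field; rewrite h1 h2.
Qed.

Lemma gb_poch (K : numFieldType) (al : K) k : gb (k%:R + al) k = poch (al + 1) k / k`!%:R.
Proof.
rewrite /gb /poch (reindex_inj rev_ord_inj) /=; congr (_ / _); apply: eq_bigr => i _.
by rewrite natrB // -[i.+1%:R]natr1; ring.
Qed.

Section Main.
Variables (alpha : R) (a : nat -> R).
Let lam n := sum_f_R0 (fun k => Rmult (a k) (Binomial.C n k)) n.
Let b k := Rmult (gbinom (Rplus (INR k) alpha) k) (a k).

Lemma lamE n : lam n = \sum_(k < n.+1) a k * 'C(n, k)%:R.
Proof. by rewrite /lam sum_f_R0_ord; apply: eq_bigr => k _; rewrite C_bin // -ltnS. Qed.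

Lemma symbol_coefE k : b k = poch (alpha + 1) k / k`!%:R * a k.
Proof. by rewrite /b gbinomE INRE -gb_poch. Qed.

Lemma multiplier_seqE : Lag_multiplier_seq alpha lam <->
  forall N (c : nat -> R), rr (\sum_(n < N.+1) c n *: lag alpha n) ->
    rr (\sum_(n < N.+1) ((\sum_(k < n.+1) a k * 'C(n, k)%:R) * c n) *: lag alpha n).
Proof.
have h1 N (c : nat -> R) := real_rooted_horner (Laguerre_sumE alpha c N).
have e N (c : nat -> R) : \sum_(n < N.+1) ((\sum_(k < n.+1) a k * 'C(n, k)%:R) * c n) *: lag alpha n =
    \sum_(n < N.+1) (lam n * c n) *: lag alpha n.
  by apply: eq_bigr => n _; rewrite lamE.
split=> H N c.
  by rewrite e => /h1 /H /(h1 _ (fun n => lam n * c n)).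
by move=> /h1 /H; rewrite e => /(h1 _ (fun n => lam n * c n)).
Qed.

Lemma symbolE : poly_rr_in_m10 b <->
  exists M, (forall i, (M < i)%N -> poch (alpha + 1) i / i`!%:R * a i = 0) /\
    exists c (rs : seq R), {in rs, forall r : R, -1 <= r <= 0} /\
      forall y, \sum_(i < M.+1) poch (alpha + 1) i / i`!%:R * a i * y ^+ i =
        c * \prod_(r <- rs) (y - r).
Proof.
have sE M y : sum_f_R0 (fun k => Rmult (b k) (pow y k)) M =
    \sum_(i < M.+1) poch (alpha + 1) i / i`!%:R * a i * y ^+ i.
  by rewrite sum_f_R0_ord; apply: eq_bigr => i _; rewrite symbol_coefE RpowE.
split=> -[M [b0 [c [rs [rsI h]]]]]; exists M; split.
- by move=> i /ssrnat.ltP Mi; rewrite -symbol_coefE b0.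
- exists c, rs; split=> [r /In_mem /rsI [/RleP ? /RleP ?]|y]; first by apply/andP.
  by rewrite -sE h prodl_map.
- by move=> i /ssrnat.ltP Mi; rewrite symbol_coefE b0.
- exists c, rs; split=> [r /In_mem /rsI /andP[/RleP ? /RleP ?]|y]; first by [].
  by rewrite sE h prodl_map.
Qed.

(** [k] is the least index of a nonzero value; non-triviality gives a nonzero value at an index
    other than [k] and [k + 1], necessarily beyond both. *)
Lemma nontrivial_gap : ~ trivial_seq lam -> exists k l, [/\ (k.+1 < l)%N, lam k != 0 & lam l != 0].
Proof.
move=> nt.
have [//|no] := Classical_Prop.classic (exists k l, [/\ (k.+1 < l)%N, lam k != 0 & lam l != 0]).
case: nt.
have [[n ln]|z] := Classical_Prop.classic (exists n, lam n != 0); last first.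
  by exists 0%N => n _ _; apply/eqP; apply: contra_notT z => ?; exists n.
have ex : exists n, lam n != 0 by exists n.
case: (ex_minnP ex) => k lk kmin; exists k => i /eqP ik /eqP ik1.
apply/eqP; apply: contra_notT no => li; exists k, i; split=> //.
have := kmin _ li; rewrite leq_eqVlt eq_sym (negPf ik) /= leq_eqVlt eq_sym.
by rewrite (negPf ik1).
Qed.

End Main.

Open Scope R_scope.

Theorem theorem1p1 (alpha : R) (a : nat -> R) (halpha : -1 < alpha) :
  let lam := fun n : nat => sum_f_R0 (fun k => a k * C n k) n in
  ~ trivial_seq lam ->
  (Lag_multiplier_seq alpha lam <->
   poly_rr_in_m10 (fun k => gbinom (INR k + alpha) k * a k)).
Proof.
move=> lam nt; have [k [l [kl lamk laml]]] := nontrivial_gap nt.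
have al1 : (-1 < alpha)%R by apply/RltP.
apply: iff_trans (multiplier_seqE alpha a) _; apply: iff_trans (iff_sym (symbolE alpha a)).
split=> [|[M [b0 [c [rs [rsI h]]]]]]; last exact: multiplier_sufficient h.
by apply: multiplier_necessary kl _ _; rewrite // -lamE.
Qed.
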